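(* Consider the convex composite problem $\min\{f(y)+g(z): \mathcal{A}^*y+\mathcal{B}^*z=c\}$ and the algorithm p-GADMM described in the context, with parameters $\sigma>0$, $\rho\in(0,2)$ and self-adjoint positive definite operators $\mathcal{S}:\mathcal{Y}\to\mathcal{Y}$, $\mathcal{T}:\mathcal{Z}\to\mathcal{Z}$. Suppose the KKT solution set $\bar\Omega$ is nonempty. Let $\{(x^k,y^k,z^k;\tilde x^k,\tilde y^k,\tilde z^k)\}$ be generated by p-GADMM, and set $\nu^k:=(x^k,y^k,\tilde y^k-y^k,z^k,\tilde z^k-z^k)\in\mathcal{V}$ for $k\ge 1$. Suppose moreover that the inverse of the KKT mapping $\hat{\mathcal{R}}$ is calm at $0\in\mathcal{V}$ for $\bar\nu$ with modulus $\lambda>0$ (where $\bar\nu\in\bar\Theta$ is the limit of $\{\nu^k\}$ appearing in the conclusion below), in the sense that there is a constant $\varepsilon>0$ with $$\operatorname{dist}(\nu,\bar\Theta)\le\lambda\|\hat{\mathcal{R}}(\nu)\|\qquad\text{for all }\nu\in\mathcal{V}\text{ with }\|\nu-\bar\nu\|\le\varepsilon .$$ Then $\{\nu^k\}$ converges to $\bar\nu=(\bar x,\bar y,0,\bar z,0)\in\bar\Theta$, and there exists a threshold $\bar k\ge 1$ such that for all $k\ge\bar k$, $$\operatorname{dist}_{\Xi}^2(\nu^{k+1},\bar\Theta)\le\alpha\,\operatorname{dist}_{\Xi}^2(\nu^{k},\bar\Theta),$$ where $$\alpha:=(1+\beta)^{-1},\qquad \beta:=(2-\rho)\min\Big\{1,\tfrac12\sigma,\sigma\rho^{-1}(2-\rho)\Big\}\big(\lambda^2\kappa\,\lambda_{\max}(\Xi)\big)^{-1},$$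 $$\kappa:=\max\Big\{\|\mathcal{S}\|,\;3\|\mathcal{T}\|,\;3(2-\rho)^2\sigma^2\lambda_{\max}(\mathcal{B}^*\mathcal{B}),\;3(1-\rho)^2\sigma^2\lambda_{\max}(\mathcal{B}^*\mathcal{B})+1\Big\}.$$ Moreover, there exists a positive number $\zeta\in[\alpha,1)$ such that for all $k\ge\bar k$, $$\operatorname{dist}_{\Xi}^2(\nu^{k+1},\bar\Theta)\le\zeta\,\operatorname{dist}_{\Xi}^2(\nu^{k},\bar\Theta).$$
   Context: Setting. $\mathcal{X},\mathcal{Y},\mathcal{Z}$ are finite-dimensional real Euclidean spaces with inner product $\langle\cdot,\cdot\rangle$ and induced norm $\|\cdot\|$; $f:\mathcal{Y}\to(-\infty,+\infty]$ and $g:\mathcal{Z}\to(-\infty,+\infty]$ are closed proper convex functions; $\mathcal{A}:\mathcal{X}\to\mathcal{Y}$, $\mathcal{B}:\mathcal{X}\to\mathcal{Z}$ are linear with adjoints $\mathcal{A}^*,\mathcal{B}^*$; $c\in\mathcal{X}$. The operators $\Sigma_f:\mathcal{Y}\to\mathcal{Y}$, $\Sigma_g:\mathcal{Z}\to\mathcal{Z}$ are self-adjoint positive semidefinite and satisfy $\langle\xi'-\xi,y'-y\rangle\ge\|y'-y\|^2_{\Sigma_f}$ for all $y,y'\in\operatorname{dom} f$, $\xi\in\partial f(y)$, $\xi'\in\partial f(y')$, and $\langle\zeta'-\zeta,z'-z\rangle\ge\|z'-z\|^2_{\Sigma_g}$ for all $z,z'\in\operatorname{dom} g$, $\zeta\in\partial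 g(z)$, $\zeta'\in\partial g(z')$. For a self-adjoint positive semidefinite operator $\mathcal{O}$, $\|u\|_{\mathcal{O}}:=\sqrt{\langle u,\mathcal{O}u\rangle}$ and $\operatorname{dist}_{\mathcal{O}}(u,C):=\inf_{v\in C}\|u-v\|_{\mathcal{O}}$; $\operatorname{dist}$ without subscript uses $\|\cdot\|$. $\|\mathcal{S}\|,\|\mathcal{T}\|$ are operator norms; $\lambda_{\max}$ is the largest eigenvalue of a self-adjoint operator. Augmented Lagrangian: $\mathcal{L}_\sigma(y,z;x):=f(y)+g(z)-\langle x,\mathcal{A}^*y+\mathcal{B}^*z-c\rangle+\frac{\sigma}{2}\|\mathcal{A}^*y+\mathcal{B}^*z-c\|^2$. Algorithm p-GADMM. Choose $(\tilde x^0,\tilde y^0,\tilde z^1)\in\mathcal{X}\times\operatorname{dom} f\times\operatorname{dom} g$. Compute $y^0:=\arg\min_y \mathcal{L}_\sigma(y,\tilde z^1;\tilde x^0)+\frac12\|y-\tilde y^0\|^2_{\mathcal{S}}$ and $x^0:=\tilde x^0-\sigma(\mathcal{A}^*y^0+\mathcal{B}^*\tilde z^1-c)$. For $k=1,2,\dots$: $z^k:=\arg\min_z\mathcal{L}_\sigma(y^{k-1},z;x^{k-1})+\frac12\|z-\tilde z^k\|^2_{\mathcal{T}}$; $\tilde y^k:=\tilde y^{k-1}+\rho(y^{k-1}-\tilde y^{k-1})$; $\tilde x^k:=\tilde x^{k-1}+\rho(x^{k-1}-\tilde x^{k-1})$; $\tilde z^{k+1}:=\tilde z^k+\rho(z^k-\tilde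 z^k)$; $y^k:=\arg\min_y\mathcal{L}_\sigma(y,\tilde z^{k+1};\tilde x^k)+\frac12\|y-\tilde y^k\|^2_{\mathcal{S}}$; $x^k:=\tilde x^k-\sigma(\mathcal{A}^*y^k+\mathcal{B}^*\tilde z^{k+1}-c)$. The algorithm is regarded as producing an infinite sequence. KKT objects. $\bar\Omega$ is the set of $(x,y,z)\in\mathcal{X}\times\mathcal{Y}\times\mathcal{Z}$ with $\mathcal{A}x\in\partial f(y)$, $\mathcal{B}x\in\partial g(z)$, $\mathcal{A}^*y+\mathcal{B}^*z-c=0$. Let $\mathcal{V}:=\mathcal{X}\times\mathcal{Y}\times\mathcal{Y}\times\mathcal{Z}\times\mathcal{Z}$ and $\bar\Theta:=\{(\bar x,\bar y,0,\bar z,0)\in\mathcal{V}:(\bar x,\bar y,\bar z)\in\bar\Omega\}$. With $\operatorname{Prox}_f(x):=\arg\min_{y}\{f(y)+\frac12\|y-x\|^2\}$ (similarly for $g$), the KKT mapping $\hat{\mathcal{R}}:\mathcal{V}\to\mathcal{V}$ is, for $\nu=(x,y,u,z,w)$, $$\hat{\mathcal{R}}(\nu):=\big(\mathcal{A}^*y+\mathcal{B}^*z-c,\;y-\operatorname{Prox}_f(y+\mathcal{A}x),\;0,\;z-\operatorname{Prox}_g(z+\mathcal{B}x),\;0\big).$$ The operator $\Xi:\mathcal{V}\to\mathcal{V}$ is $$\Xi:=\begin{pmatrix}(\sigma\rho)^{-1}\mathcal{I}&(1-\rho)\rho^{-1}\mathcal{A}^*&0&0&0\\(1-\rho)\rho^{-1}\mathcal{A}&\rho^{-1}\sigma\mathcal{A}\mathcal{A}^*+\rho^{-1}\mathcal{S}+2\Sigma_f&(1-\rho)\rho^{-1}\mathcal{S}&0&0\\0&(1-\rho)\rho^{-1}\mathcal{S}&\rho^{-1}\mathcal{S}&0&0\\0&0&0&\rho^{-1}\mathcal{T}+2\Sigma_g&(1-\rho)\rho^{-1}\mathcal{T}\\0&0&0&(1-\rho)\rho^{-1}\mathcal{T}&(1-\rho)^2\rho^{-1}\mathcal{T}\end{pmatrix}+\tfrac12(2-\rho)\sigma\,\vartheta\vartheta^*,$$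 where $\mathcal{I}$ is the identity and $\vartheta:\mathcal{X}\to\mathcal{V}$ is the linear operator whose adjoint is $\vartheta^*(x,y,u,z,w)=\mathcal{A}^*y+\mathcal{B}^*z$.
   Formalization: In the y-subproblem the constant g(z̃) is dropped: for ρ>1 the point z̃ may leave dom g, and then L_σ(·,z̃;x) is identically +∞ and its argmin undefined; the step is unchanged when g(z̃) is finite. The case where all spaces are {0}, with λ_max(Ξ) undefined, is excluded. *)

(* Defs.v *)
From HB Require Import structures.
From mathcomp Require Import all_boot all_order all_algebra.
From mathcomp Require Import all_classical all_reals all_analysis.

Set Implicit Arguments.
Unset Strict Implicit.
Unset Printing Implicit Defensive.

Import Order.TTheory GRing.Theory Num.Theory.
Import numFieldNormedType.Exports.

Local Open Scope classical_set_scope.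
Local Open Scope ring_scope.

(* A finite-dimensional real Euclidean space is a [vectType R] together with a
   positive definite symmetric form [ip : {dot E for idfun}].  The definitions
   below only need the underlying function [E -> E -> R]. *)

Section Euclidean.
Context {R : realType}.

Definition enorm {E : lmodType R} (ip : E -> E -> R) (u : E) : R :=
  Num.sqrt (ip u u).

Definition enormO {E : lmodType R} (ip : E -> E -> R) (O : E -> E) (u : E) : R :=
  Num.sqrt (ip u (O u)).

Definition dist {E : lmodType R} (ip : E -> E -> R) (u : E) (C : set E) : R :=
  inf [set enorm ip (u - v) | v in C].

Definition distO {E : lmodType R} (ip : E -> E -> R) (O : E -> E) (u : E)
    (C : set E) : R :=
  inf [set enormO ip O (u - v) | v in C].

Definition self_adjoint {E : lmodType R} (ip : E -> E -> R) (O : E -> E) :=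
  forall u v, ip (O u) v = ip u (O v).

Definition psd_op {E : lmodType R} (ip : E -> E -> R) (O : E -> E) :=
  self_adjoint ip O /\ forall u, 0 <= ip u (O u).

Definition pd_op {E : lmodType R} (ip : E -> E -> R) (O : E -> E) :=
  self_adjoint ip O /\ forall u, u != 0 -> 0 < ip u (O u).

Definition is_adjoint {E F : lmodType R} (ipE : E -> E -> R)
    (ipF : F -> F -> R) (L : E -> F) (Ls : F -> E) :=
  forall u v, ipF (L u) v = ipE u (Ls v).

Definition opnorm {E : lmodType R} (ip : E -> E -> R) (O : E -> E) : R :=
  sup [set enorm ip (O u) | u in [set u | enorm ip u <= 1]].

(* On a nonzero space a self-adjoint operator has a nonempty finite set of
   eigenvalues, so the supremum is a maximum; on the zero space it is 0. *)
Definition lambda_max {E : vectType R} (O : 'End(E)) : R :=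
  sup [set l | passmx.leigenvalue O l].

Definition norm_cvg {E : lmodType R} (ip : E -> E -> R) (u : nat -> E) (l : E) :=
  (fun k => enorm ip (u k - l)) @ \oo --> (0 : R).

End Euclidean.

Section Convex.
Context {R : realType}.
Local Open Scope ereal_scope.

Definition edom {E : Type} (f : E -> \bar R) : set E := [set x | f x < +oo].

Definition proper_fun {E : Type} (f : E -> \bar R) :=
  (forall x, f x != -oo) /\ edom f !=set0.

Definition convex_fun {E : lmodType R} (f : E -> \bar R) :=
  forall (x y : E) (t : R), (0 < t < 1)%R ->
    f (t *: x + (1 - t) *: y)%R <= t%:E * f x + (1 - t)%:E * f y.

(* Lower semicontinuity for the norm of [ip]; [E] carries no topology. *)
Definition closed_fun {E : lmodType R} (ip : E -> E -> R) (f : E -> \bar R) :=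
  forall (x : E) (a : R), a%:E < f x ->
    exists2 e : R, (0 < e)%R &
      forall y, (enorm ip (y - x) < e)%R -> a%:E < f y.

Definition closed_proper_convex {E : lmodType R} (ip : E -> E -> R)
    (f : E -> \bar R) :=
  [/\ closed_fun ip f, proper_fun f & convex_fun f].

Definition subdiff {E : lmodType R} (ip : E -> E -> R) (f : E -> \bar R)
    (x : E) : set E :=
  [set xi | edom f x /\ forall x', f x + (ip xi (x' - x)%R)%:E <= f x'].

Definition subdiff_monotone {E : lmodType R} (ip : E -> E -> R)
    (f : E -> \bar R) (Sig : E -> E) :=
  forall x x' xi xi' : E, edom f x -> edom f x' ->
    subdiff ip f x xi -> subdiff ip f x' xi' ->
    (ip (xi' - xi) (x' - x) >= enormO ip Sig (x' - x) ^+ 2)%R.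

Definition is_argmin {E : Type} (F : E -> \bar R) (x : E) :=
  forall x', F x <= F x'.

(* For closed proper convex [f] the minimizer exists and is unique; otherwise
   the value is an arbitrary minimizer, or 0 if there is none. *)
Definition prox {E : vectType R} (ip : E -> E -> R) (f : E -> \bar R)
    (x : E) : E :=
  xget (0 : E)%R
    [set y | is_argmin (fun v => f v + (2^-1 * enorm ip (v - x) ^+ 2)%:E) y].

End Convex.

Definition kkt_space {R : realType} (X Y Z : vectType R) : vectType R :=
  (X * Y * Y * Z * Z)%type.

Section PGADMM.
Context {R : realType} {X Y Z : vectType R}.
Context (ipX : X -> X -> R) (ipY : Y -> Y -> R) (ipZ : Z -> Z -> R).
Context (f : Y -> \bar R) (g : Z -> \bar R).
(* [As] and [Bs] stand for the adjoints of [A] and [B]. *)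
Context (A : 'Hom(X, Y)) (As : 'Hom(Y, X)) (B : 'Hom(X, Z)) (Bs : 'Hom(Z, X)).
Context (c : X) (sigma rho : R).
Context (S : 'End(Y)) (T : 'End(Z)) (Sigf : 'End(Y)) (Sigg : 'End(Z)).

Definition auglag (f' : Y -> \bar R) (g' : Z -> \bar R)
    (y : Y) (z : Z) (x : X) : \bar R :=
  (f' y + g' z +
   (- ipX x (As y + Bs z - c)
    + sigma / 2 * enorm ipX (As y + Bs z - c) ^+ 2)%:E)%E.

Definition zstep_obj (y : Y) (x : X) (zt z : Z) : \bar R :=
  (auglag f g y z x + (2^-1 * enormO ipZ T (z - zt) ^+ 2)%:E)%E.

(* In the y-step the term [g zt] does not depend on the minimization variable
   and is dropped.  This matters because for [1 < rho] the relaxed point [zt]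
   may leave [edom g]: the full Lagrangian would then be identically [+oo] and
   every point would be a minimizer.  See [argmin_ystepE]. *)
Definition ystep_obj (zt : Z) (xt : X) (yt y : Y) : \bar R :=
  (auglag f (cst 0%E) y zt xt + (2^-1 * enormO ipY S (y - yt) ^+ 2)%:E)%E.

Lemma argmin_ystepE (zt : Z) (xt : X) (yt y : Y) : g zt \is a fin_num ->
  is_argmin (ystep_obj zt xt yt) y <->
  is_argmin (fun y' => auglag f g y' zt xt +
                       (2^-1 * enormO ipY S (y' - yt) ^+ 2)%:E)%E y.
Proof.
move=> gfin.
have E y' : (auglag f g y' zt xt + (2^-1 * enormO ipY S (y' - yt) ^+ 2)%:E
           = ystep_obj zt xt yt y' + g zt)%E.
  by rewrite /ystep_obj /auglag /= adde0 [(f y' + g zt)%E]addeC -!addeA addeC -!addeA.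
by split=> H y'; have := H y'; rewrite ?E leeD2rE // !E leeD2rE.
Qed.

(* The values [z 0] and [zt 0] are not used by the algorithm. *)
Definition pGADMM (x xt : nat -> X) (y yt : nat -> Y) (z zt : nat -> Z) : Prop :=
  [/\ edom f (yt 0%N), edom g (zt 1%N),
      is_argmin (ystep_obj (zt 1%N) (xt 0%N) (yt 0%N)) (y 0%N),
      x 0%N = xt 0%N - sigma *: (As (y 0%N) + Bs (zt 1%N) - c) &
      forall k, (1 <= k)%N ->
        is_argmin (zstep_obj (y k.-1) (x k.-1) (zt k)) (z k) /\
        [/\ yt k = yt k.-1 + rho *: (y k.-1 - yt k.-1),
            xt k = xt k.-1 + rho *: (x k.-1 - xt k.-1),
            zt k.+1 = zt k + rho *: (z k - zt k),
            is_argmin (ystep_obj (zt k.+1) (xt k) (yt k)) (y k) &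
            x k = xt k - sigma *: (As (y k) + Bs (zt k.+1) - c)]].

Definition nu_seq (x : nat -> X) (y yt : nat -> Y) (z zt : nat -> Z) (k : nat)
    : kkt_space X Y Z :=
  (x k, y k, yt k - y k, z k, zt k - z k).

Definition ipV (nu nu' : kkt_space X Y Z) : R :=
  let: (x, y, u, z, w) := nu in
  let: (x', y', u', z', w') := nu' in
  ipX x x' + ipY y y' + ipY u u' + ipZ z z' + ipZ w w'.

Definition Omega (x : X) (y : Y) (z : Z) : Prop :=
  [/\ subdiff ipY f y (A x), subdiff ipZ g z (B x) & As y + Bs z - c = 0].

Definition Theta : set (kkt_space X Y Z) :=
  [set nu | exists x y z, Omega x y z /\ nu = (x, y, 0, z, 0)].

Definition kkt_map (nu : kkt_space X Y Z) : kkt_space X Y Z :=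
  let: (x, y, u, z, w) := nu in
  (As y + Bs z - c, y - prox ipY f (y + A x), 0, z - prox ipZ g (z + B x), 0).

Definition kkt_calm (lambda : R) (nub : kkt_space X Y Z) : Prop :=
  exists2 eps : R, 0 < eps &
    forall nu, enorm ipV (nu - nub) <= eps ->
      dist ipV nu Theta <= lambda * enorm ipV (kkt_map nu).

Definition vtheta (x : X) : kkt_space X Y Z := (0, A x, 0, B x, 0).

Definition vtheta_adj (nu : kkt_space X Y Z) : X :=
  let: (x, y, u, z, w) := nu in As y + Bs z.

Definition Xi_block (nu : kkt_space X Y Z) : kkt_space X Y Z :=
  let: (x, y, u, z, w) := nu in
  ((sigma * rho)^-1 *: x + ((1 - rho) / rho) *: As y,
   ((1 - rho) / rho) *: A x
     + ((sigma / rho) *: A (As y) + rho^-1 *: S y + 2 *: Sigf y)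
     + ((1 - rho) / rho) *: S u,
   ((1 - rho) / rho) *: S y + rho^-1 *: S u,
   (rho^-1 *: T z + 2 *: Sigg z) + ((1 - rho) / rho) *: T w,
   ((1 - rho) / rho) *: T z + ((1 - rho) ^+ 2 / rho) *: T w).

Definition Xi_fun (nu : kkt_space X Y Z) : kkt_space X Y Z :=
  Xi_block nu + (2^-1 * (2 - rho) * sigma) *: vtheta (vtheta_adj nu).

Fact Xi_fun_is_linear : linear Xi_fun.
Proof.
have pairE (U V : vectType R) (a : R) (u u' : U) (v v' : V) :
  a *: (u, v) + (u', v') = (a *: u + u', a *: v + v') by [].
have addE (U V : vectType R) (u u' : U) (v v' : V) :
  (u, v) + (u', v') = (u + u', v + v') by [].
have sclE (U V : vectType R) (a : R) (u : U) (v : V) :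
  a *: (u, v) = (a *: u, a *: v) by [].
move=> a [[[[x y] u] z] w] [[[[x' y'] u'] z'] w'].
rewrite /Xi_fun /Xi_block /vtheta /vtheta_adj.
rewrite !pairE !addE !sclE.
have sc (U : vectType R) (b : R) (p : U) : b *: (a *: p) = a *: (b *: p).
  by rewrite !scalerA mulrC.
have l4 (U : vectType R) (p q p' q' : U) :
    (a *: p + p') + (a *: q + q') = a *: (p + q) + (p' + q').
  by rewrite scalerDr addrACA.
by congr (_, _, _, _, _); rewrite ?linearP /= ?linearP /=
   ?[_ *: (_ *: _ + _)]scalerDr ?sc ?l4 ?linearP /= ?scaler0 ?addr0
   ?[_ *: (_ *: _ + _)]scalerDr ?sc ?l4.
Qed.


HB.instance Definition _ :=
  GRing.isLinear.Build R (kkt_space X Y Z) (kkt_space X Y Z) _ Xi_fun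
    Xi_fun_is_linear.

Definition Xi : 'End(kkt_space X Y Z) := linfun Xi_fun.

Lemma XiE nu : Xi nu = Xi_fun nu.
Proof. by rewrite lfunE. Qed.

Definition kappa : R :=
  Num.max (opnorm ipY S) (Num.max (3 * opnorm ipZ T)
    (Num.max (3 * (2 - rho) ^+ 2 * sigma ^+ 2 * lambda_max (Bs \o B)%VF)
             (3 * (1 - rho) ^+ 2 * sigma ^+ 2 * lambda_max (Bs \o B)%VF + 1))).

Definition beta (lambda : R) : R :=
  (2 - rho) * Num.min 1 (Num.min (sigma / 2) (sigma / rho * (2 - rho)))
  * (lambda ^+ 2 * kappa * lambda_max Xi)^-1.

Definition alpha (lambda : R) : R := (1 + beta lambda)^-1.

End PGADMM.

Lemma vtheta_is_adjoint {R : realType} {X Y Z : vectType R}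
    (ipX : {dot X for idfun}) (ipY : {dot Y for idfun}) (ipZ : {dot Z for idfun})
    (A : 'Hom(X, Y)) (As : 'Hom(Y, X)) (B : 'Hom(X, Z)) (Bs : 'Hom(Z, X)) :
  is_adjoint ipX ipY A As -> is_adjoint ipX ipZ B Bs ->
  is_adjoint ipX (ipV ipX ipY ipZ) (vtheta A B) (vtheta_adj As Bs).
Proof.
move=> hA hB x [[[[x' y] u] z] w] /=.
by rewrite !linear0l !add0r !addr0 hA hB linearDr.
Qed.

(* Main.v *)
Require Import Defs.
From mathcomp Require Import all_boot all_order all_algebra.
From mathcomp Require Import all_classical all_reals all_analysis.
From mathcomp Require Import ring lra.

Set Implicit Arguments.
Unset Strict Implicit.
Unset Printing Implicit Defensive.

Import Order.TTheory GRing.Theory Num.Theory.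
Import numFieldNormedType.Exports.
Import VectorInternalTheory.

Local Open Scope classical_set_scope.
Local Open Scope ring_scope.

(** The successive-monotonicity inequality for the [y]-subgradients turns the
    exact identity for the [Xi]-form into a descent estimate
    [Phi (nu k - nus) - Phi (nu (k+1) - nus) >= (2 - rho) * (...)] valid for
    every [nus] in [Theta]. Boundedness then gives a cluster point, which lies in
    [Theta] because subdifferentials are closed, and the descent with respect to
    that point forces convergence of the whole sequence. The same four terms bound
    [kappa^-1 * |kkt_map (nu (k+1))|^2], so calmness converts the descent into a
    contraction of the squared [Xi]-distance; [zeta := alpha] works. *)

(** Two obstacles shape the argument. The [T]-block of the [Xi]-form is a perfect square in
    [z + (1 - rho) w], so the form may be degenerate and its monotone decrease does not by itself
    bound the iterates; the missing [T]-norm of [zt - z] is recovered from the decrease, which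
    dominates it. Moreover the [z]-step uses the previous multiplier: its subgradient matches the
    KKT system at the new [x] only up to multiples of the new residual and of the increment
    [As (y' - y)]. These errors produce the [Bs \o B] entries of [kappa], and they are why the
    decrease has to control that increment. The factors 3 in [kappa] come from splitting a square of
    three terms. The minimum in [beta] is the smallest weight among the terms of the decrease, and
    [lambda_max Xi] compares the [Xi]-distance with the Euclidean one. Calmness is applied at the
    later iterate, so the factor [1 + beta] lands on the left, whence its inverse [alpha]. Forms are
    plain functions with a symmetry record, so that inner products, [S]- and [T]-weighted forms and
    degenerate forms share the same lemmas. *)

Ltac vect_ring :=
  apply: v2r_inj; apply/rowP => ?;
  by rewrite !(linearD, linearN, linearZ) /= !mxE; ring.

(** * Symmetric bilinear forms *)

Section SymmetricForms.
Context {R : realType} {E : lmodType R}.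
Implicit Types (q : E -> E -> R) (u v w : E) (a : R).

Record sym_form q : Prop := SymForm {
  formC : forall u v, q u v = q v u;
  formPl : forall a u v w, q (a *: u + v) w = a * q u w + q v w }.

Definition psd_form q := sym_form q /\ forall u, 0 <= q u u.
Definition pd_form q := sym_form q /\ forall u, u != 0 -> 0 < q u u.

Section Expansion.
Context q (qs : sym_form q).

Lemma formDl u v w : q (u + v) w = q u w + q v w.
Proof. by rewrite -[u]scale1r (formPl qs) mul1r scale1r. Qed.

Lemma form0l w : q 0 w = 0.
Proof. by have := formDl 0 0 w; rewrite addr0; lra. Qed.

Lemma formZl a u w : q (a *: u) w = a * q u w.
Proof. by rewrite -[a *: u]addr0 (formPl qs) form0l addr0. Qed.

Lemma formNl u w : q (- u) w = - q u w.
Proof. by rewrite -scaleN1r formZl mulN1r. Qed.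

Lemma formDr u v w : q w (u + v) = q w u + q w v.
Proof. by rewrite !(formC qs w) formDl. Qed.

Lemma form0r w : q w 0 = 0.
Proof. by rewrite (formC qs) form0l. Qed.

Lemma formZr a u w : q w (a *: u) = a * q w u.
Proof. by rewrite !(formC qs w) formZl. Qed.

Lemma formNr u w : q w (- u) = - q w u.
Proof. by rewrite !(formC qs w) formNl. Qed.

Definition formE :=
  (formDl, formDr, formZl, formZr, formNl, formNr, form0l, form0r).

Lemma form_subC u v : q (u - v) (u - v) = q (v - u) (v - u).
Proof. by rewrite -opprB formNl formNr opprK. Qed.

End Expansion.

Lemma pd_form_psd q : pd_form q -> psd_form q.
Proof.
move=> [qs qp]; split=> // u; have [->|u0] := eqVneq u 0; last exact/ltW/qp.
by rewrite (form0l qs).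
Qed.

Lemma pd_form_eq0 q u : pd_form q -> q u u <= 0 -> u = 0.
Proof.
by move=> [_ qp] qu; apply/eqP; apply: contraTT qu => /qp; rewrite ltNge.
Qed.

Lemma form_cauchy_schwarz q u v : psd_form q ->
  q u v ^+ 2 <= q u u * q v v.
Proof.
move=> [qs q0].
have := q0 (q v v *: u - q u v *: v); have := q0 (q u u *: v - q u v *: u).
have := q0 (u + v); have := q0 (u - v); have := q0 u; have := q0 v.
rewrite !(formE qs) (formC qs v u).
move: (q u u) (q u v) (q v v) => a b c c0 a0 h1 h2 h3 h4.
have h5 : 0 <= c * (a * c - b ^+ 2) by move: h4; nra.
have h6 : 0 <= a * (a * c - b ^+ 2) by move: h3; nra.
(* The form may vanish on both vectors; then only the values at [u + v] and [u - v] force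
   [b = 0]. *)
rewrite -subr_ge0; have [cp|c_le0] := ltP 0 c; first by rewrite pmulr_rge0 in h5.
have [ap|a_le0] := ltP 0 a; first by rewrite pmulr_rge0 in h6.
have -> : b = 0 by lra.
have -> : c = 0 by lra.
by rewrite mulr0 expr0n subr0.
Qed.

Lemma psd_form_kernel q u v : psd_form q -> q u u = 0 -> q u v = 0.
Proof.
move=> qp qu0; have := form_cauchy_schwarz u v qp.
rewrite qu0 mul0r => h; apply/eqP; rewrite -sqrf_eq0; apply/eqP/le_anti.
by rewrite h sqr_ge0.
Qed.

Lemma form_young q u v a : psd_form q -> 0 < a ->
  2 * q u v <= a * q u u + a^-1 * q v v.
Proof.
move=> [qs q0] a0; have := q0 (a *: u - v); rewrite !(formE qs) (formC qs v u).
have an0 : a != 0 by rewrite gt_eqF.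
rewrite -(pmulr_rge0 _ (_ : 0 < a^-1)) ?invr_gt0//.
set lhs := (X in 0 <= X).
have -> : lhs = a * q u u + a^-1 * q v v - 2 * q u v by rewrite /lhs; field.
lra.
Qed.

Lemma form_sqD2 q u v : psd_form q ->
  q (u + v) (u + v) <= 2 * (q u u + q v v).
Proof.
move=> [qs q0]; have := q0 (u - v).
by rewrite !(formE qs) (formC qs v u); lra.
Qed.

Lemma form_sqD3 q u v w : psd_form q ->
  q (u + v + w) (u + v + w) <= 3 * (q u u + q v v + q w w).
Proof.
move=> [qs q0]; have := q0 (u - v); have := q0 (v - w); have := q0 (u - w).
by rewrite !(formE qs) (formC qs v u) (formC qs w u) (formC qs w v); lra.
Qed.

Lemma enorm_sq q u : psd_form q -> enorm q u ^+ 2 = q u u.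
Proof. by move=> [_ q0]; rewrite sqr_sqrtr. Qed.

Lemma enorm_ge0 q u : 0 <= enorm q u. Proof. exact: sqrtr_ge0. Qed.

Lemma form_op q (O : {linear E -> E}) : sym_form q -> self_adjoint q O ->
  sym_form (fun u v => q u (O v)).
Proof.
move=> qs Osa; split=> [u v|a u v w]; first by rewrite -Osa (formC qs).
by rewrite (formPl qs).
Qed.

Lemma psd_form_op q (O : {linear E -> E}) : sym_form q -> psd_op q O ->
  psd_form (fun u v => q u (O v)).
Proof. by move=> qs [Osa O0]; split=> //; apply: form_op. Qed.

Lemma pd_form_op q (O : {linear E -> E}) : sym_form q -> pd_op q O ->
  pd_form (fun u v => q u (O v)).
Proof. by move=> qs [Osa O0]; split=> //; apply: form_op. Qed.

Lemma enormO_sq q (O : E -> E) u : 0 <= q u (O u) ->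
  enormO q O u ^+ 2 = q u (O u).
Proof. by move=> h; rewrite sqr_sqrtr. Qed.

Lemma dot_pd_form (q : {dot E for idfun}) : pd_form q.
Proof.
split=> [|u u0]; last exact: neq0_dnorm_gt0.
split=> [u v|a u v w]; last by rewrite linearPl.
by have := hermC q u v; rewrite expr0 mul1r.
Qed.

End SymmetricForms.

Lemma sym_formD (R : realType) (E : lmodType R) (q1 q2 : E -> E -> R) :
  sym_form q1 -> sym_form q2 -> sym_form (fun u v => q1 u v + q2 u v).
Proof.
move=> s1 s2; split=> [u v|a u v w].
  by rewrite (formC s1) (formC s2).
by rewrite (formPl s1) (formPl s2); ring.
Qed.

Lemma sym_formZ (R : realType) (E : lmodType R) (b : R) (q : E -> E -> R) :
  sym_form q -> sym_form (fun u v => b * q u v).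
Proof.
move=> s; split=> [u v|a u v w]; first by rewrite (formC s).
by rewrite (formPl s); ring.
Qed.

Lemma sym_form_comp (R : realType) (E F : lmodType R) (L : {linear E -> F})
    (q : F -> F -> R) :
  sym_form q -> sym_form (fun u v => q (L u) (L v)).
Proof.
move=> s; split=> [u v|a u v w]; first by rewrite (formC s).
by rewrite linearP (formPl s).
Qed.

(** * Compactness and extremal eigenvalues *)

Section Compactness.
Context {R : realType} {E : vectType R}.
Implicit Types (p q : E -> E -> R) (u v : E).

Local Notation n := (dim E).

Lemma continuous_sum_seq (T : topologicalType) (I : Type) (s : seq I)
    (F : I -> T -> R) :
  (forall i, continuous (F i)) -> continuous (fun t => \sum_(i <- s) F i t).
Proof.
move=> cF; elim: s => [|i s IH] t.
  rewrite (_ : (fun _ => _) = cst 0); last by apply/funext => ?; rewrite big_nil.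
  exact: cst_continuous.
rewrite (_ : (fun _ => _) = F i \+ (fun t => \sum_(j <- s) F j t)); last first.
  by apply/funext => ?; rewrite big_cons.
by apply: continuousD; [exact: cF|exact: IH].
Qed.

Lemma form_coordE q (qs : sym_form q) (r : 'rV[R]_n) :
  q (r2v r) (r2v r) = \sum_i \sum_j
    r 0 i * r 0 j * q (r2v (delta_mx 0 i)) (r2v (delta_mx 0 j)).
Proof.
have suml (I : Type) (s : seq I) (F : I -> E) w :
    q (\sum_(i <- s) F i) w = \sum_(i <- s) q (F i) w.
  elim: s => [|i s IH]; first by rewrite !big_nil (form0l qs).
  by rewrite !big_cons (formDl qs) IH.
have qr w : q (r2v r) w = \sum_i r 0 i * q (r2v (delta_mx 0 i)) w.
  rewrite {1}[r]row_sum_delta linear_sum suml; apply: eq_bigr => i _.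
  by rewrite linearZ (formZl qs).
rewrite qr; apply: eq_bigr => i _; rewrite (formC qs) qr mulr_sumr.
by apply: eq_bigr => j _; rewrite (formC qs) mulrA.
Qed.

Lemma form_continuous q : sym_form q ->
  continuous (fun r : 'rV[R]_n => q (r2v r) (r2v r)).
Proof.
move=> qs; rewrite (_ : (fun _ => _) = fun r : 'rV[R]_n => \sum_i \sum_j
    r 0 i * r 0 j * q (r2v (delta_mx 0 i)) (r2v (delta_mx 0 j))); last first.
  by apply/funext => r; rewrite form_coordE.
apply: continuous_sum_seq => i; apply: continuous_sum_seq => j r.
have ci := @coord_continuous R 1 n 0 i r.
have cj := @coord_continuous R 1 n 0 j r.
exact: (continuousM (continuousM ci cj) (@cst_continuous _ _ _ _)).
Qed.

(** The quotient of the two forms is homogeneous of degree 0, so its maximum over the compact unit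
    sphere of the coordinate norm is global. The vector [v] only witnesses that the sphere is
    nonempty. *)
Lemma form_ratio_max p q v : pd_form p -> sym_form q -> v != 0 ->
  exists2 v0, v0 != 0 & forall u, p v0 v0 * q u u <= q v0 v0 * p u u.
Proof.
move=> [ps pp] qs vn0.
pose h (r : 'rV[R]_n) := q (r2v r) (r2v r) / p (r2v r) (r2v r).
have nrm0 w : w != 0 -> 0 < `|v2r w|.
  move=> w0; rewrite normr_gt0; apply: contraNneq w0 => w0.
  by rewrite -[w]v2rK w0 linear0.
pose K := [set r : 'rV[R]_n | `|r| = 1].
have unitK w : w != 0 -> K (`|v2r w|^-1 *: v2r w).
  move=> w0; rewrite /K /= normrZ normfV normr_id mulVf // gt_eqF //.
  exact: nrm0.
have r0 r : K r -> r2v r != 0.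
  rewrite /K /= => r1; apply/eqP => e.
  move: r1; rewrite -[r]r2vK e linear0 normr0 => /eqP.
  by rewrite eq_sym oner_eq0.
have cK : compact K.
  apply: bounded_closed_compact.
    by exists 1; split=> // M M1 r; rewrite /K /= => ->; apply: ltW.
  apply: (@closed_comp _ _ (fun r : 'rV[R]_n => `|r|) [set x : R | x = 1]).
    by move=> r _; exact: norm_continuous.
  exact: closed_eq.
have hc : {within K, continuous h}.
  apply: continuous_in_subspaceT => r; rewrite inE => Kr.
  have pr0 : p (r2v r) (r2v r) != 0 by rewrite gt_eqF // pp // r0.
  have cq := form_continuous qs (x := r); have cp := form_continuous ps (x := r).
  exact: (continuousM cq (continuousV pr0 cp)).
have [|r /set_mem Kr rmax] := @compact_EVT_max _ R h K _ cK hc.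
  by exists (`|v2r v|^-1 *: v2r v); exact: unitK.
exists (r2v r); first exact: r0.
move=> u; have [->|u0] := eqVneq u 0.
  by rewrite (form0r qs) (form0r ps) !mulr0.
have := rmax _ (mem_set (unitK _ u0)).
have t0 : `|v2r u|^-1 != 0 by rewrite invr_eq0 gt_eqF // nrm0.
rewrite /h linearZ /= v2rK.
rewrite (formZl qs) (formZr qs) (formZl ps) (formZr ps).
set t := `|_|^-1 in t0 *.
rewrite [X in X <= _](_ : _ = q u u / p u u); last first.
  by field; rewrite t0 gt_eqF // pp.
by rewrite ler_pdivrMr ?pp // mulrAC ler_pdivlMr ?pp ?r0 // mulrC.
Qed.

Lemma form_bounded p q : pd_form p -> sym_form q ->
  exists2 C : R, 0 < C & forall u, q u u <= C * p u u.
Proof.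
move=> pp qs; have [_ pp0] := pp.
have [[v v0]|/forallNP all0] := pselect (exists v : E, v != 0); last first.
  exists 1 => // u; have -> : u = 0 by apply/eqP/negPn/negP; exact: all0.
  by rewrite (form0r qs) (form0r (proj1 pp)) mulr0.
have [v1 v10 vmax] := form_ratio_max pp qs v0.
have pv1 := pp0 _ v10.
exists (`|q v1 v1 / p v1 v1| + 1) => [|u]; first by rewrite ltr_wpDl.
apply: (@le_trans _ _ (q v1 v1 / p v1 v1 * p u u)).
  by rewrite mulrAC ler_pdivlMr // mulrC.
apply: ler_wpM2r; first by have [_] := pd_form_psd pp; apply.
by rewrite (le_trans (ler_norm _)) // lerDl.
Qed.

Lemma sym_form_dot_coord :
  pd_form (fun u v : E => \sum_i v2r u 0 i * v2r v 0 i).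
Proof.
split=> [|u u0].
  split=> [u v|a u v w]; first by apply: eq_bigr => i _; rewrite mulrC.
  rewrite mulr_sumr -big_split; apply: eq_bigr => i _ /=.
  by rewrite linearP !mxE; ring.
rewrite lt_def sumr_ge0 ?andbT; last by move=> i _; rewrite -expr2 sqr_ge0.
apply: contra_neq u0 => /eqP.
rewrite psumr_eq0; last by move=> i _; rewrite -expr2 sqr_ge0.
move=> /allP u0; rewrite -[u]v2rK.
rewrite (_ : v2r u = 0) ?linear0 //; apply/rowP => i; rewrite mxE.
by have := u0 i (mem_index_enum _); rewrite /= mulf_eq0 orbb => /eqP.
Qed.

(** Bolzano-Weierstrass, transported through coordinates because [E] carries no topology; comparing
    the coordinate form with [p] confines the coordinates to a closed ball. *)
Lemma form_bounded_cluster p (u : nat -> E) (M : R) : pd_form p ->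
  (forall k, p (u k) (u k) <= M) ->
  exists l, forall (e : R) N, 0 < e ->
    exists2 k, (N <= k)%N & p (u k - l) (u k - l) < e.
Proof.
move=> pp uM; have [ps _] := pp.
have [C C0 Cb] := form_bounded pp (proj1 sym_form_dot_coord).
pose b := Num.sqrt (C * M).
pose K := [set r : 'rV[R]_n | `|r| <= b].
have cK : compact K.
  apply: bounded_closed_compact.
    exists b; split=> [|M' bM' r]; first exact: num_real.
    by rewrite /K /= => rb; rewrite (le_trans rb) // ltW.
  apply: (@closed_comp _ _ (fun r : 'rV[R]_n => `|r|) [set x : R | x <= b]).
    by move=> r _; exact: norm_continuous.
  exact: closed_le.
have uK k : K (v2r (u k)).
  rewrite /K /= [leLHS]/Num.norm /= mx_normrE; apply/bigmax_leP; split => /=.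
    exact: sqrtr_ge0.
  move=> [i j] _ /=; rewrite (ord1 i) -sqrtr_sqr ler_wsqrtr //.
  apply: (@le_trans _ _ (C * p (u k) (u k))); last by rewrite ler_wpM2l // ltW.
  apply: le_trans (Cb (u k)); rewrite (bigD1 j) //= expr2 lerDl.
  by rewrite sumr_ge0 // => i' _; rewrite -expr2 sqr_ge0.
have [|r [_ rcl]] := cK ((v2r \o u) @ \oo) _.
  by exists 0%N => // k _; exact: uK.
exists (r2v r) => e N e0.
pose W := [set s : 'rV[R]_n | p (r2v (s - r)) (r2v (s - r)) < e].
have Wr : nbhs r W.
  have sub0 : (fun s : 'rV[R]_n => s - r) @ nbhs r --> (0 : 'rV[R]_n).
    rewrite -(subrr r).
    by apply: (@cvgB R 'rV[R]_n _ (nbhs r)); [exact: cvg_id|exact: cvg_cst].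
  have := cvg_comp _ _ sub0 (form_continuous ps (x := 0)).
  rewrite linear0 (form0l ps) => /(_ [set t | t < e]); apply.
  by apply: open_nbhs_nbhs; split => //; exact: open_lt.
have [] := rcl [set s | exists2 k, (N <= k)%N & s = v2r (u k)] W _ Wr.
  by exists N => // k Nk /=; exists k.
move=> s [[k Nk ->] Ws]; exists k => //.
by move: Ws; rewrite /W /= linearB /= v2rK.
Qed.

End Compactness.

Section ExtremalEigenvalue.
Context {R : realType} {E : vectType R}.
Variable p : E -> E -> R.
Hypothesis pp : pd_form p.
Implicit Types O : 'End(E).

Lemma leigenvalueP O l :
  reflect (exists2 w, O w = l *: w & w != 0) (passmx.leigenvalue O l).
Proof.
rewrite /passmx.leigenvalue /passmx.leigenspace -vpick0.
have opE u : (O - l *: \1%VF)%VF u = O u - l *: u.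
  by rewrite add_lfunE opp_lfunE scale_lfunE id_lfunE.
apply: (iffP idP) => [w0|[w Ow w0]].
  exists (vpick (lker (O - l *: \1%VF))) => //.
  have := memv_pick (lker (O - l *: \1%VF)).
  by rewrite memv_ker opE subr_eq0 => /eqP.
have : w \in lker (O - l *: \1%VF).
  by rewrite memv_ker opE Ow subrr.
by rewrite vpick0; apply: contraTneq => ->; rewrite memv0.
Qed.

(** A maximizer [w] of the Rayleigh quotient, with maximum [m], is isotropic for the semidefinite
    form [m p - p (., O .)], hence lies in its radical and is an eigenvector. This identifies the
    supremum of the eigenvalues with [m]. *)
Lemma form_le_lambda_max O v : self_adjoint p O ->
  p v (O v) <= lambda_max O * p v v.
Proof.
move=> Osa; have [ps p0] := pp.
have qs := form_op ps Osa.
have [->|v0] := eqVneq v 0; first by rewrite !(form0l ps) mulr0.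
have [w w0 wmax] := form_ratio_max pp qs v0.
have pw := p0 _ w0.
set m := p w (O w) / p w w.
have mmax u : p u (O u) <= m * p u u.
  by rewrite mulrAC ler_pdivlMr // mulrC.
have rs : sym_form (fun u v => m * p u v + - 1 * p u (O v)).
  exact: (sym_formD (sym_formZ _ ps) (sym_formZ _ qs)).
have rp : psd_form (fun u v => m * p u v + - 1 * p u (O v)).
  by split=> // u; rewrite mulN1r subr_ge0.
have Ow : O w = m *: w.
  apply/eqP; rewrite -subr_eq0; apply/eqP/(pd_form_eq0 pp).
  have := @psd_form_kernel _ _ _ w (O w - m *: w) rp.
  rewrite divfK ?gt_eqF // mulN1r subrr => /(_ erefl); rewrite -Osa.
  set d := O w - _ => h.
  have -> : p d d = p (O w) d - m * p w d.
    by rewrite {1}/d (formDl ps) (formNl ps) (formZl ps).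
  by lra.
have em : passmx.leigenvalue O m.
  by apply/leigenvalueP; exists w.
have eb l : passmx.leigenvalue O l -> l <= m.
  move=> /leigenvalueP [z Oz z0].
  have := mmax z; rewrite Oz (formZr ps) ler_pM2r //; exact: p0.
suff -> : lambda_max O = m by exact: mmax.
apply/le_anti/andP; split.
  by apply: ge_sup; [exists m|move=> l /eb].
by apply: ub_le_sup => //; exists m => l /eb.
Qed.

Lemma lambda_max_ge0 O : psd_op p O -> 0 <= lambda_max O.
Proof.
move=> [Osa O0]; have [_ p0] := pp.
have [[v v0]|/forallNP all0] := pselect (exists v : E, v != 0).
  rewrite -(pmulr_lge0 _ (p0 _ v0)); apply: le_trans (form_le_lambda_max v Osa).
  exact: O0.
rewrite /lambda_max (_ : [set l | _] = set0) ?sup0 //.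
by apply/seteqP; split=> // l /= /leigenvalueP [w _ /all0].
Qed.

Lemma enorm0_eq u : enorm p u = 0 -> u = 0.
Proof.
move=> u0; apply: (pd_form_eq0 pp).
by rewrite -(enorm_sq u (pd_form_psd pp)) u0 expr0n.
Qed.

Lemma le_opnorm O u : enorm p (O u) <= opnorm p O * enorm p u.
Proof.
have [ps p0] := pp; have pq := pd_form_psd pp.
have [/enorm0_eq ->|u0] := eqVneq (enorm p u) 0.
  by rewrite linear0 /enorm (form0l ps) sqrtr0 mulr0.
have un0 : 0 < enorm p u by rewrite lt_def u0 enorm_ge0.
rewrite -ler_pdivrMr //.
(* [opnorm] is a real supremum, meaningful only once the set of values is known to be bounded. *)
have [C C0 Cb] := form_bounded pp (sym_form_comp O ps).
apply: ub_le_sup.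
  exists (Num.sqrt C) => _ [w w1 <-]; apply: ler_wsqrtr.
  apply: le_trans (Cb _) _; rewrite ler_piMr ?(ltW C0) //.
  by rewrite -(enorm_sq _ pq) expr_le1 // enorm_ge0.
have nZ w : enorm p ((enorm p u)^-1 *: w) = (enorm p u)^-1 * enorm p w.
  rewrite /enorm (formZl ps) (formZr ps) mulrA -expr2 sqrtrM ?sqr_ge0 //.
  by rewrite sqrtr_sqr ger0_norm // invr_ge0 sqrtr_ge0.
exists ((enorm p u)^-1 *: u) => /=; first by rewrite nZ mulVf.
by rewrite linearZ nZ mulrC.
Qed.

(** Cauchy-Schwarz for the [O]-weighted form at [u] and [O u] gives
    [|O u|^4 <= <u, O u> <O u, O (O u)>]. Only one factor of the norm is spent, which is why [kappa]
    contains norms and not their squares. *)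
Lemma form_op_le_opnorm O u : psd_op p O ->
  p (O u) (O u) <= opnorm p O * p u (O u).
Proof.
move=> Op; have [Osa O0] := Op; have [ps p0] := pp; have pq := pd_form_psd pp.
have [->|Ou0] := eqVneq (O u) 0; first by rewrite !(form0r ps) mulr0.
have pOu := p0 _ Ou0.
have oq := psd_form_op ps Op.
have h1 : p (O u) (O u) ^+ 2 <= p u (O u) * p (O u) (O (O u)).
  by have := form_cauchy_schwarz u (O u) oq; rewrite /= -(Osa u (O u)).
have h2 : p (O u) (O (O u)) <= opnorm p O * p (O u) (O u).
  apply: (@le_trans _ _ (enorm p (O u) * enorm p (O (O u)))).
    rewrite /enorm -sqrtrM ?(ltW pOu) //.
    rewrite (le_trans (ler_norm _)) // -sqrtr_sqr ler_wsqrtr //.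
    exact: form_cauchy_schwarz.
  rewrite -[in leRHS](enorm_sq _ pq) expr2 mulrCA ler_wpM2l ?enorm_ge0 //.
  exact: le_opnorm.
rewrite -(ler_pM2r pOu) -expr2; apply: le_trans h1 _.
by rewrite mulrAC [leRHS]mulrC ler_wpM2l // O0.
Qed.

End ExtremalEigenvalue.
(** * Subdifferentials and proximal points *)

Section ConvexFunctions.
Context {R : realType} {E : vectType R}.
Variables (p : E -> E -> R) (f : E -> \bar R).
Hypothesis pp : pd_form p.
Hypothesis fp : closed_proper_convex p f.

Let ps : sym_form p := proj1 pp.
Let pq : psd_form p := pd_form_psd pp.

Lemma form_le_enorm u v : p u v <= enorm p u * enorm p v.
Proof.
rewrite /enorm -sqrtrM; last by case: pq => _; apply.
rewrite (le_trans (ler_norm _)) // -sqrtr_sqr ler_wsqrtr //.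
exact: form_cauchy_schwarz.
Qed.

Lemma edomP u : edom f u -> exists a, f u = a%:E.
Proof.
case: fp => _ [fN _] _; rewrite /edom /=; move: (fN u).
by case: (f u) => // a _ _; exists a.
Qed.

(** First-order optimality for [f + h] with [h] quadratic of gradient [G] at [x]: compare [x] with
    [x + t (x' - x)], divide by [t] and let [t] tend to 0. *)
Lemma argmin_subdiff (h C : E -> R) (x G : E) :
  (forall t d, h (x + t *: d) = h x + t * p G d + t ^+ 2 * C d) ->
  is_argmin (fun v => f v + (h v)%:E)%E x -> subdiff p f x (- G).
Proof.
move=> hE xmin; have [_ [fN [x0 x0f]] fconv] := fp.
have xf : edom f x.
  have := xmin x0; have [b ->] := edomP x0f; rewrite /edom /=.
  by move: (fN x); case: (f x) => // r _ _; exact: ltry.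
split=> // x'; have [a fx] := edomP xf; have [->|] := eqVneq (f x') +oo%E.
  by rewrite leey.
rewrite -ltey => /edomP [b fx']; rewrite fx fx' -EFinD lee_fin.
rewrite (formNl ps); set g := p G _; set c := C (x' - x).
have key t : 0 < t < 1 -> 0 <= b - a + g + t * c.
  move=> t01; have /andP [t0 t1] := t01.
  have := fconv x' x t t01; rewrite fx fx' -!EFinM -EFinD.
  have := xmin (t *: x' + (1 - t) *: x).
  have -> : t *: x' + (1 - t) *: x = x + t *: (x' - x).
    by rewrite scalerBl scale1r scalerBr addrCA.
  rewrite hE fx; move: (fN (x + t *: (x' - x))).
  case: (f _) => // d _; rewrite -!EFinD !lee_fin -/g -/c => h1 h2.
  rewrite -(pmulr_rge0 _ t0).
  have -> : t * (b - a + g + t * c) =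
      t * b - t * a + t * g + t ^+ 2 * c by ring.
  by lra.
rewrite leNgt; apply/negP => lt; set e := a - g - b.
have e0 : 0 < e by rewrite /e; lra.
have c0 : 0 < 2 * (`|c| + 1 + e) by rewrite mulr_gt0 // ltr_wpDl // addr_ge0.
(* This [t] is below 1 and makes the curvature term [t * c] at most half of the supposed gap [e]. *)
have tb : 0 < e / (2 * (`|c| + 1 + e)) < 1.
  rewrite divr_gt0 // ltr_pdivrMr // mul1r /=.
  by have := normr_ge0 c; lra.
have := key _ tb.
apply/negP; rewrite -ltNge.
have : e / (2 * (`|c| + 1 + e)) * c <= e / 2.
  apply: (@le_trans _ _ (e / (2 * (`|c| + 1 + e)) * `|c|)).
    by rewrite ler_wpM2l ?ler_norm // ltW // divr_gt0.
  rewrite mulrAC ler_pdivrMr // -mulrA ler_wpM2l ?(ltW e0) //.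
  by have := normr_ge0 c; lra.
by rewrite /e; lra.
Qed.

Lemma lt_edom_between x (b : R) : (b%:E < f x)%E ->
  exists2 s : R, 0 < s & ((b + s)%:E < f x)%E.
Proof.
case: (f x) => [a| |] //=; last by move=> _; exists 1; rewrite ?ltry.
rewrite lte_fin => ba; exists ((a - b) / 2); first by rewrite divr_gt0 ?subr_gt0.
by rewrite lte_fin; lra.
Qed.

Lemma subdiff_closed x xi :
  (forall e, 0 < e -> exists x' xi', [/\ subdiff p f x' xi',
     enorm p (x' - x) < e & enorm p (xi' - xi) < e]) ->
  subdiff p f x xi.
Proof.
move=> cl; have [flsc [fN [x0 x0f]] _] := fp.
(* Proved before [f x] is known to be finite: applied at a point of the domain it yields exactly
   that finiteness. *)
have main y b : f y = b%:E -> (f x + (p xi (y - x))%:E <= b%:E)%E.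
  move=> fy; rewrite -leeBrDr // -EFinB leNgt; apply/negP => lt.
  have [s s0 lts] := lt_edom_between lt.
  have [e e0 fe] := flsc _ _ lts.
  set N1 := enorm p (y - x); set N2 := enorm p xi.
  have N10 : 0 <= N1 by exact: enorm_ge0.
  have N20 : 0 <= N2 by exact: enorm_ge0.
  have N0 : 0 < N1 + N2 + 1 by rewrite ltr_wpDl // addr_ge0.
  (* Three error terms, bounded by [d * N1], [d * N2] and [d * d <= d], must fit into the slack
     [s]. *)
  set d := Num.min 1 (Num.min e (s / (N1 + N2 + 1))).
  have d0 : 0 < d by rewrite !lt_min ltr01 e0 divr_gt0.
  have [d1 de ds] : [/\ d <= 1, d <= e & d * (N1 + N2 + 1) <= s].
    by split; rewrite -?ler_pdivlMr // !ge_min lexx ?orbT.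
  have [x' [xi' [[_ /(_ y) sub] nx nxi]]] := cl _ d0.
  have := lt_le_trans nx de => /fe; move: sub; rewrite fy.
  move: (fN x'); case: (f x') => // a _; rewrite -EFinD lee_fin lte_fin => h1 h2.
  have e1 : p xi' (y - x') = p xi (y - x) + p (xi' - xi) (y - x)
      - p (xi' - xi) (x' - x) - p xi (x' - x).
    by rewrite !(formE ps); ring.
  have i1 : - p (xi' - xi) (y - x) <= d * N1.
    rewrite -(formNl ps); apply: le_trans (form_le_enorm _ _) _.
    rewrite ler_wpM2r //; apply: ltW; apply: le_lt_trans nxi.
    by rewrite /enorm form_subC ?opprB //; exact: ps.
  have i2 : p (xi' - xi) (x' - x) <= d * 1.
    apply: le_trans (form_le_enorm _ _) _.
    by rewrite ler_pM ?enorm_ge0 // ltW // (lt_le_trans nx).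
  have i3 : p xi (x' - x) <= d * N2.
    apply: le_trans (form_le_enorm _ _) _.
    by rewrite mulrC ler_wpM2r ?enorm_ge0 // ltW.
  by move: h1 h2 ds; rewrite e1 mulrDr mulrDr; lra.
have xf : edom f x.
  have [b fx0] := edomP x0f; have := main _ _ fx0.
  by rewrite /edom /=; move: (fN x); case: (f x) => // r _ _; exact: ltry.
split=> // y; have [->|] := eqVneq (f y) +oo%E; first by rewrite leey.
by rewrite -ltey => /edomP [b fy]; rewrite fy; exact: main.
Qed.

(** A subgradient supplies an affine minorant of [f], so the regularized objective is bounded below
    with bounded sublevel sets. A cluster point of a minimizing sequence is then a minimizer by
    lower semicontinuity. *)
Lemma prox_exists y eta c : subdiff p f y eta ->
  exists x, is_argmin (fun v => f v + (2^-1 * enorm p (v - c) ^+ 2)%:E)%E x.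
Proof.
move=> [yf sub]; have [flsc [fN _] _] := fp; have [a fy] := edomP yf.
have sq v : enorm p v ^+ 2 = p v v by exact: enorm_sq.
pose L := [set r : R | exists v, (f v + (2^-1 * p (v - c) (v - c))%:E = r%:E)%E].
have low v r : (f v + (2^-1 * p (v - c) (v - c))%:E = r%:E)%E ->
    4^-1 * p (v - c) (v - c) <= r - a - p eta (c - y) + p eta eta.
  move=> e; have := sub v; rewrite fy; move: e.
  case: (f v) => // b; rewrite -!EFinD lee_fin => -[<-] h.
  have := form_young eta (- (v - c)) pq (ltr0Sn R 1).
  rewrite (formNr ps) (formNl ps) (formNr ps) opprK.
  have : p eta (v - y) = p eta (v - c) + p eta (c - y).
    by rewrite !(formE ps); ring.
  by move: h; have := proj2 pq (v - c); lra.
have L0 : L !=set0.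
  by exists (a + 2^-1 * p (y - c) (y - c)); exists y; rewrite fy -EFinD.
have Llb : has_lbound L.
  exists (a + p eta (c - y) - p eta eta) => r [v /low].
  by have := proj2 pq (v - c); lra.
have Linf : has_inf L by [].
pose m := inf L.
have /choice [v vm] : forall k : nat, exists v : E, exists2 r : R,
    (f v + (2^-1 * p (v - c) (v - c))%:E = r%:E)%E & r < m + k.+1%:R^-1.
  move=> k; have k0 : 0 < k.+1%:R^-1 :> R by rewrite invr_gt0.
  by have [r [v vr] rm] := inf_adherent k0 Linf; exists v, r.
have vb k : p (v k - c) (v k - c) <=
    4 * (m + 1 - a - p eta (c - y) + p eta eta).
  have [r vr rm] := vm k; have := low _ _ vr.
  have : k.+1%:R^-1 <= 1 :> R by rewrite invf_le1 // ler1n.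
  move: (k.+1%:R^-1) rm => q rm q1 h; lra.
have [l' l'cl] := form_bounded_cluster (u := fun k => v k - c) pp vb.
exists (l' + c) => w; rewrite !sq addrK.
set x := l' + c.
suff fx : (f x + (2^-1 * p l' l')%:E <= m%:E)%E.
  apply: le_trans fx _.
  move: (fN w); case fw : (f w) => [b| |] // _; last by rewrite leey.
  by rewrite -EFinD lee_fin; apply: ge_inf => //; exists w; rewrite fw.
rewrite -leeBrDr // -EFinB leNgt; apply/negP => lt.
have [s s0 lts] := lt_edom_between lt.
have [e e0 fe] := flsc _ _ lts.
have N0 := enorm_ge0 p l'.
(* The slack [s] is shared: half pays for the change of the quadratic term within distance [d], half
   for the excess of [v k] over the infimum. *)
set d := Num.min e (s / (2 * (enorm p l' + 1))).
have n0 : 0 < 2 * (enorm p l' + 1) by rewrite mulr_gt0 // ltr_wpDl.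
have d0 : 0 < d by rewrite lt_min e0 divr_gt0.
have [de ds] : d <= e /\ d * (2 * (enorm p l' + 1)) <= s.
  by split; rewrite -?ler_pdivlMr // ge_min lexx ?orbT.
have [N _ hN] : \forall k \near \oo, (k.+1%:R^-1 < s / 2).
  have s20 : 0 < s / 2 by rewrite divr_gt0.
  exact: (near_infty_natSinv_lt (PosNum s20)).
have [k Nk vk] := l'cl (d ^+ 2) N (exprn_gt0 _ d0).
have {hN} := hN k Nk; rewrite /= => ks.
have vx : enorm p (v k - x) < d.
  rewrite -(@ltr_pXn2r _ 2) ?nnegrE ?enorm_ge0 ?(ltW d0) // sq.
  by rewrite /x opprD addrA addrAC.
have := fe _ (lt_le_trans vx de).
have [r] := vm k; move: (fN (v k)); case: (f (v k)) => // b _.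
rewrite -EFinD lte_fin => -[re] rm h.
have e1 : p (v k - c) (v k - c) =
    p l' l' + 2 * p l' (v k - x) + p (v k - x) (v k - x).
  have -> : v k - c = l' + (v k - x) by rewrite /x opprD addrCA addNKr.
  by move: (v k - x) => w'; rewrite !(formE ps) (formC ps w' l'); ring.
have i1 : - p l' (v k - x) <= enorm p l' * d.
  rewrite -(formNr ps); apply: le_trans (form_le_enorm _ _) _.
  rewrite ler_wpM2l // ltW //; apply: le_lt_trans vx.
  by rewrite /enorm (formNl ps) (formNr ps) opprK.
have := proj2 pq (v k - x); move: ds; rewrite mulrCA mulrDr mulr1 (mulrC d).
by move: re rm ks; rewrite e1; move: (k.+1%:R^-1) => q; lra.
Qed.

(** Since [y] is the proximal point of [y + eta], this is nonexpansiveness of the proximal map. It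
    turns an inexact optimality condition with error [s] into a bound on a component of
    [kkt_map]. *)
Lemma prox_residual y eta s : subdiff p f y eta ->
  p (y - prox p f (y + eta - s)) (y - prox p f (y + eta - s)) <= p s s.
Proof.
move=> sub; set c := y + eta - s; set x := prox p f c.
have xmin : is_argmin (fun v => f v + (2^-1 * enorm p (v - c) ^+ 2)%:E)%E x.
  have [x' x'min] := prox_exists c sub.
  exact: (@xgetI _ 0 [set z | is_argmin _ z] x' x'min).
have subx : subdiff p f x (- (x - c)).
  apply: (argmin_subdiff (C := fun d => 2^-1 * p d d) _ xmin) => t d.
  rewrite !(enorm_sq _ pq) [x + _ - c]addrAC.
  move: (x - c) => b; rewrite !(formE ps) (formC ps d b).
  by field.
have : 0 <= p (eta + (x - c)) (y - x).
  case: sub => yf suby; case: subx => xf subx.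
  have := suby x; have := subx y.
  have [a ->] := edomP yf; have [b ->] := edomP xf.
  rewrite -!EFinD !lee_fin !(formE ps); lra.
have -> : eta + (x - c) = s - (y - x).
  rewrite /c !opprB (addrCA x) (addrCA eta) opprD; congr (s + _).
  by rewrite addrC addrA addrNK.
move: (y - x) => d; rewrite (formDl ps) (formNl ps) subr_ge0 => h.
have := form_cauchy_schwarz s d pq; have := proj2 pq d; have := proj2 pq s.
move: (p s d) (p s s) (p d d) h => g u w h u0 w0 cs.
by rewrite leNgt; apply/negP => lt; nra.
Qed.

End ConvexFunctions.
(** * The algorithm *)

Section StepOptimality.
Context {R : realType} {X E : vectType R}.
Variables (ipX : X -> X -> R) (ip : E -> E -> R) (phi : E -> \bar R).
Hypotheses (pX : pd_form ipX) (pE : pd_form ip).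
Hypothesis phi_cpc : closed_proper_convex ip phi.

(** Common shape of both subproblems: [b] collects the constraint terms frozen in the step, and
    [x - s *: (L u + b)] is the multiplier after a full dual step. *)
Lemma argmin_step_subdiff (L : 'Hom(E, X)) (Ls : 'Hom(X, E)) (O : 'End(E))
    (x b : X) (s : R) (t u : E) :
  is_adjoint ipX ip Ls L -> psd_op ip O ->
  is_argmin (fun v => phi v + (- ipX x (L v + b)
    + s / 2 * enorm ipX (L v + b) ^+ 2 + 2^-1 * enormO ip O (v - t) ^+ 2)%:E)%E u ->
  subdiff ip phi u (Ls (x - s *: (L u + b)) + O (t - u)).
Proof.
move=> Ladj [Osa O0] umin; have [psX _] := pX; have [psE _] := pE.
have -> : Ls (x - s *: (L u + b)) + O (t - u) =
    - (O (u - t) - Ls (x - s *: (L u + b))).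
  by rewrite opprB -(opprB u t) linearN.
apply: (argmin_subdiff pE phi_cpc
  (C := fun d => s / 2 * ipX (L d) (L d) + 2^-1 * ip d (O d)) _ umin) => r d.
rewrite !(enorm_sq _ (pd_form_psd pX)) !(enormO_sq (O0 _)).
have -> : L (u + r *: d) + b = L u + b + r *: L d.
  by rewrite linearD linearZ addrAC.
have -> : u + r *: d - t = u - t + r *: d by rewrite addrAC.
rewrite [ip (O _ - _) _](formDl psE) (formNl psE) Ladj.
move: (L u + b) (u - t) (L d) => k e l.
rewrite linearD linearZ /= !(formE psX) !(formE psE) (formC psX l k) -!Osa (formC psE (O d) e) -Osa.
by field.
Qed.

End StepOptimality.

(** * Exact identities for the relaxed recursions *)

Section RelaxationIdentities.
Context {R : realType}.

(** Each coupled pair of components contributes one such form to the [Xi]-form, as [Xi_formE]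
    shows. *)
Definition quad2 {E : lmodType R} (a b c : R) (q : E -> E -> R) (u v : E) : R :=
  a * q u u + 2 * b * q u v + c * q v v.

Context {E : lmodType R} (q : E -> E -> R) (qs : sym_form q).
Variables (rho : R) (rho0 : rho != 0).

Lemma quad2_relax (e e' u u' : E) : u' = (1 - rho) *: u + e - e' ->
  quad2 rho^-1 ((1 - rho) / rho) rho^-1 q e u
    - quad2 rho^-1 ((1 - rho) / rho) rho^-1 q e' u'
  = 2 * q u' e' + (2 - rho) * q u u.
Proof.
move=> ->; rewrite /quad2 !(formE qs).
by rewrite (formC qs u e) (formC qs u e') (formC qs e' e); field.
Qed.

(** In contrast with [quad2_relax], the surplus square already sits at the new index, so the
    [T]-term of the decrease comes without comparing successive subgradients. *)
Lemma quad2_relax_swap (z z' w w' : E) : w' = (1 - rho) *: w + z - z' ->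
  quad2 rho^-1 ((1 - rho) / rho) ((1 - rho) ^+ 2 / rho) q z w
    - quad2 rho^-1 ((1 - rho) / rho) ((1 - rho) ^+ 2 / rho) q z' w'
  = 2 * q w' z' + (2 - rho) * q w' w'.
Proof.
move=> ->; rewrite /quad2 !(formE qs).
by rewrite (formC qs w z) (formC qs w z') (formC qs z' z); field.
Qed.

Lemma quad2_multiplier (sigma : R) (x x' h h' g' : E) : sigma != 0 ->
  x' = x + ((1 - rho) * sigma) *: (h + g') - sigma *: (h' + g') ->
  quad2 (sigma * rho)^-1 ((1 - rho) / rho) (sigma / rho) q x h
    - quad2 (sigma * rho)^-1 ((1 - rho) / rho) (sigma / rho) q x' h'
  = 2 * q x' h' + 2 * q (x - sigma *: (h + g')) g'
    + (2 - rho) * sigma * q (h + g') (h + g').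
Proof.
move=> s0 ->; rewrite /quad2 !(formE qs).
rewrite (formC qs h x) (formC qs h' x) (formC qs g' x) (formC qs h' h).
by rewrite (formC qs g' h) (formC qs g' h'); field; rewrite rho0 s0.
Qed.

(* Applied with [t := sigma * <q, a>] and [n := sigma * |a|^2], where
   [q := As y_k + Bs z_(k+1) - c] and [a := As (y_(k+1) - y_k)]. *)
Lemma quad2_successive (y y' u u' : E) (t n : R) : 0 < rho < 2 ->
  psd_form q -> u' = (1 - rho) *: u + y - y' ->
  0 <= - rho * t - n + q (u' - u) (y' - y) ->
  q u' u' + 2 * t + 2 / rho * n <= q u u.
Proof.
move=> /andP[r0 r2] [_ q0] u'E.
have -> : y' - y = (1 - rho) *: u - u'.
  by rewrite u'E opprB addrCA opprD addNKr.
have := q0 (u - u'); rewrite !(formE qs) (formC qs u' u).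
move: (q u u) (q u u') (q u' u') => a b e abe h.
rewrite -(ler_pM2l r0).
have -> : rho * (e + 2 * t + 2 / rho * n) = rho * e + 2 * rho * t + 2 * n.
  by field.
have : 0 <= (2 - rho) * (a - b - b + e) by rewrite mulr_ge0 //; lra.
lra.
Qed.

End RelaxationIdentities.

Lemma subdiff_monotone_ge0 (R : realType) (E : vectType R) (q : E -> E -> R) (phi : E -> \bar R)
    (O : 'End(E)) (v v' s s' : E) :
  psd_op q O -> subdiff_monotone q phi O ->
  subdiff q phi v s -> subdiff q phi v' s' ->
  q (v' - v) (O (v' - v)) <= q (s' - s) (v' - v).
Proof.
move=> [_ O0] Omon sv sv'; rewrite -(enormO_sq (O0 _)).
by apply: Omon => //; [case: sv|case: sv'].
Qed.

Lemma telescoping_small (R : realType) (d D : nat -> R) :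
  (forall k, 0 <= d k) -> (forall k, 0 <= D k) ->
  (forall k, D k <= d k - d k.+1) ->
  forall e, 0 < e -> exists N, forall k, (N <= k)%N -> D k < e.
Proof.
move=> d0 D0 dD e e0.
have lb : has_lbound (range d) by exists 0 => _ [k _ <-].
have [] := @inf_adherent R (range d) e e0.
  by split; [exists (d 0%N); exists 0%N|].
move=> _ [N _ <-] dN; exists N => k Nk.
have dk : d k <= d N.
  elim: k Nk => [|k IH]; first by rewrite leqn0 => /eqP ->.
  rewrite leq_eqVlt => /orP[/eqP ->//|/IH]; apply: le_trans.
  by rewrite -subr_ge0; exact: le_trans (dD k).
have : inf (range d) <= d k.+1 by apply: ge_inf => //; exists k.+1.
by have := dD k; lra.
Qed.

(** * Definiteness of the blocks of the [Xi]-form *)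

Section RelaxationForm.
Context {R : realType} {E : lmodType R} (q : E -> E -> R).
Variables (rho s : R).
Hypotheses (rho_bnd : 0 < rho < 2) (s_gt0 : 0 < s).

(** Diagonalization of the block: both weights are positive exactly when [0 < rho < 2]. The case
    [s = 1] serves the [S]-block, the case [s = sigma] the multiplier block. *)
Lemma quad2_squares u v : sym_form q ->
  quad2 (s * rho)^-1 ((1 - rho) / rho) (s / rho) q u v =
  (s * rho)^-1 * ((2 - rho) / 2 * q (u + s *: v) (u + s *: v)
                  + rho / 2 * q (u - s *: v) (u - s *: v)).
Proof.
move=> qs; have [r0 _] := andP rho_bnd; rewrite /quad2 !(formE qs) (formC qs v u).
by field; rewrite !gt_eqF.
Qed.

Lemma quad2_ge0 u v : psd_form q ->
  0 <= quad2 (s * rho)^-1 ((1 - rho) / rho) (s / rho) q u v.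
Proof.
move=> [qs q0]; have [r0 r2] := andP rho_bnd; rewrite quad2_squares //.
rewrite mulr_ge0 ?invr_ge0 ?mulr_ge0 ?(ltW s_gt0) ?(ltW r0) //.
by rewrite addr_ge0 // mulr_ge0 ?q0 // divr_ge0 ?(ltW r0) // subr_ge0 ltW.
Qed.

Lemma quad2_eq0 u v : pd_form q ->
  quad2 (s * rho)^-1 ((1 - rho) / rho) (s / rho) q u v <= 0 -> u = 0 /\ v = 0.
Proof.
move=> qp; have [qs q0] := pd_form_psd qp; have [r0 r2] := andP rho_bnd.
rewrite quad2_squares // pmulr_rle0 ?invr_gt0 ?mulr_gt0 //.
have := q0 (u + s *: v); have := q0 (u - s *: v).
set a := q (u - _) _; set b := q (u + _) _ => a0 b0 h.
have h1 : 0 <= (2 - rho) / 2 * b by rewrite mulr_ge0 // divr_ge0 // subr_ge0 ltW.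
have h2 : 0 <= rho / 2 * a by rewrite mulr_ge0 // divr_ge0 // ltW.
have {}a0 : a <= 0 by rewrite -(pmulr_rle0 _ (_ : 0 < rho / 2)) ?divr_gt0 //; lra.
have {}b0 : b <= 0.
  by rewrite -(pmulr_rle0 _ (_ : 0 < (2 - rho) / 2)) ?divr_gt0 ?subr_gt0 //; lra.
have /eqP := pd_form_eq0 qp a0; have /eqP := pd_form_eq0 qp b0.
rewrite subr_eq0 addr_eq0 => /eqP uv /eqP vu.
have sv0 : s *: v = 0.
  have : 2%:R *: (s *: v) = 0 by rewrite scaler_nat mulr2n -{1}vu uv addNr.
  by move=> /eqP; rewrite scaler_eq0 pnatr_eq0 /= => /eqP.
split; first by rewrite vu.
by move: sv0 => /eqP; rewrite scaler_eq0 gt_eqF //= => /eqP.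
Qed.

End RelaxationForm.

(** The [T]-block has zero determinant: this is the source of the degeneracy of [Xi]. *)
Lemma quad2_swap_square (R : realType) (E : lmodType R) (q : E -> E -> R)
    (rho : R) u v : rho != 0 -> sym_form q ->
  quad2 rho^-1 ((1 - rho) / rho) ((1 - rho) ^+ 2 / rho) q u v =
  rho^-1 * q (u + (1 - rho) *: v) (u + (1 - rho) *: v).
Proof. by move=> r0 qs; rewrite /quad2 !(formE qs) (formC qs v u); field. Qed.

Lemma ipV_pd_form (R : realType) (X Y Z : vectType R) (ipX : X -> X -> R)
    (ipY : Y -> Y -> R) (ipZ : Z -> Z -> R) :
  pd_form ipX -> pd_form ipY -> pd_form ipZ -> pd_form (ipV ipX ipY ipZ).
Proof.
move=> pX pY pZ.
have [[sX _] [sY _] [sZ _]] := And3 pX pY pZ.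
split.
  split=> [[[[[x y] u] z] w] [[[[x' y'] u'] z'] w']|a
    [[[[x y] u] z] w] [[[[x' y'] u'] z'] w'] [[[[x2 y2] u2] z2] w2]] /=.
    rewrite (formC sX x) (formC sY y) (formC sY u) (formC sZ z) (formC sZ w).
    by [].
  by rewrite !(formPl sX) !(formPl sY) !(formPl sZ); ring.
move=> [[[[x y] u] z] w]; apply: contraNT; rewrite -leNgt /= => h.
have := proj2 (pd_form_psd pX) x; have := proj2 (pd_form_psd pY) y.
have := proj2 (pd_form_psd pY) u; have := proj2 (pd_form_psd pZ) z.
have := proj2 (pd_form_psd pZ) w => h1 h2 h3 h4 h5.
rewrite (pd_form_eq0 (u := x) pX); last by lra.
rewrite (pd_form_eq0 (u := y) pY); last by lra.
rewrite (pd_form_eq0 (u := u) pY); last by lra.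
rewrite (pd_form_eq0 (u := z) pZ); last by lra.
by rewrite (pd_form_eq0 (u := w) pZ); last by lra.
Qed.

Lemma le0_of_le_mule (R : realFieldType) (t C : R) : 0 < C ->
  (forall e, 0 < e -> t <= C * e) -> t <= 0.
Proof.
move=> C0 h; rewrite leNgt; apply/negP => t0.
have := h (t / (2 * C)) (divr_gt0 t0 (mulr_gt0 (ltr0Sn _ 1) C0)).
by rewrite (_ : C * _ = t / 2); [lra|field; rewrite gt_eqF].
Qed.

Lemma exists_scaled_lt_sqr (R : realFieldType) (K e : R) : 0 < K -> 0 < e ->
  exists2 d : R, 0 < d & K * d + d < e ^+ 2.
Proof.
move=> K0 e0; have K1 : 0 < K + 1 by rewrite ltr_wpDl // ltW.
have e2 : 0 < e ^+ 2 by rewrite exprn_gt0.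
exists (e ^+ 2 / (2 * (K + 1))); first by rewrite divr_gt0 // mulr_gt0.
have -> : K * (e ^+ 2 / (2 * (K + 1))) + e ^+ 2 / (2 * (K + 1)) = e ^+ 2 / 2.
  by field; rewrite gt_eqF.
by lra.
Qed.

Lemma linear_bounded (R : realType) (E F : vectType R) (p : E -> E -> R)
    (q : F -> F -> R) (L : 'Hom(E, F)) : pd_form p -> sym_form q ->
  exists2 C : R, 0 < C & forall v, q (L v) (L v) <= C * p v v.
Proof. by move=> pp qs; exact: form_bounded pp (sym_form_comp L qs). Qed.

Lemma ipV_components (R : realType) (X Y Z : vectType R) (ipX : X -> X -> R)
    (ipY : Y -> Y -> R) (ipZ : Z -> Z -> R) (a : X) (b d : Y) (e h : Z) :
  pd_form ipX -> pd_form ipY -> pd_form ipZ ->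
  let n := ipV ipX ipY ipZ (a, b, d, e, h) (a, b, d, e, h) in
  [/\ ipX a a <= n, ipY b b <= n, ipY d d <= n, ipZ e e <= n & ipZ h h <= n].
Proof.
move=> /pd_form_psd[_ pX] /pd_form_psd[_ pY] /pd_form_psd[_ pZ] /=.
have := pX a; have := pY b; have := pY d; have := pZ e; have := pZ h.
move: (ipX _ _) (ipY _ _) (ipY _ _) (ipZ _ _) (ipZ _ _) => t1 t2 t3 t4 t5.
by split; lra.
Qed.

Lemma enorm_lt (R : realType) (E : vectType R) (p : E -> E -> R) (v : E) (e : R) :
  psd_form p -> 0 < e -> p v v < e ^+ 2 -> enorm p v < e.
Proof.
move=> pp e0; rewrite -(enorm_sq v pp) ltr_pXn2r // nnegrE ?enorm_ge0 //.
exact: ltW.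
Qed.

(** * Squared distances as infima *)

Section DistanceSquared.
Context {R : realType} {E : vectType R} (p : E -> E -> R) (O : E -> E).
Hypothesis O0 : forall u, 0 <= p u (O u).
Implicit Types (v th : E) (C : set E).

Lemma distO_ge0 v C : C !=set0 -> 0 <= distO p O v C.
Proof.
move=> [th Cth]; apply: lb_le_inf; first by exists (enormO p O (v - th)), th.
by move=> _ [w _ <-]; exact: sqrtr_ge0.
Qed.

Lemma distO_sq_le v th C : C th ->
  distO p O v C ^+ 2 <= p (v - th) (O (v - th)).
Proof.
move=> Cth; rewrite -(enormO_sq (O0 _)) ler_pXn2r ?nnegrE ?sqrtr_ge0 //.
  by apply: ge_inf; [exists 0 => _ [w _ <-]; exact: sqrtr_ge0|exists th].
by apply: distO_ge0; exists th.
Qed.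

(** With [distO_sq_le] this reduces inequalities between squared distances to pointwise ones,
    without a nearest point. Taking the identity for [O] covers [dist]. *)
Lemma le_distO_sq v C c : C !=set0 ->
  (forall th, C th -> c <= p (v - th) (O (v - th))) -> c <= distO p O v C ^+ 2.
Proof.
move=> C0 h; have [c0|c0] := ltP c 0.
  by rewrite (le_trans (ltW c0)) // sqr_ge0.
rewrite -[c]sqr_sqrtr // ler_pXn2r ?nnegrE ?sqrtr_ge0 ?distO_ge0 //.
apply: lb_le_inf; first by case: C0 => th Cth; exists (enormO p O (v - th)), th.
by move=> _ [th Cth <-]; rewrite /enormO ler_wsqrtr // h.
Qed.

End DistanceSquared.

Section Algorithm.
Context {R : realType} {X Y Z : vectType R}.
Variables (ipX : X -> X -> R) (ipY : Y -> Y -> R) (ipZ : Z -> Z -> R).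
Variables (f : Y -> \bar R) (g : Z -> \bar R).
Variables (A : 'Hom(X, Y)) (As : 'Hom(Y, X)) (B : 'Hom(X, Z)) (Bs : 'Hom(Z, X)).
Variables (c : X) (sigma rho : R) (S : 'End(Y)) (T : 'End(Z)).
Variables (Sigf : 'End(Y)) (Sigg : 'End(Z)).
Hypotheses (pX : pd_form ipX) (pY : pd_form ipY) (pZ : pd_form ipZ).
Hypothesis f_cpc : closed_proper_convex ipY f.
Hypothesis g_cpc : closed_proper_convex ipZ g.
Hypothesis A_adj : is_adjoint ipX ipY A As.
Hypothesis B_adj : is_adjoint ipX ipZ B Bs.
Hypotheses (S_psd : psd_op ipY S) (T_psd : psd_op ipZ T).
Hypotheses (Sigf_psd : psd_op ipY Sigf) (Sigf_mon : subdiff_monotone ipY f Sigf).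
Hypotheses (Sigg_psd : psd_op ipZ Sigg) (Sigg_mon : subdiff_monotone ipZ g Sigg).
Hypotheses (sigma_gt0 : 0 < sigma) (rho_bnd : 0 < rho < 2).
Variables (x xt : nat -> X) (y yt : nat -> Y) (z zt : nat -> Z).
Hypothesis gen : pGADMM ipX ipY ipZ f g As Bs c sigma rho S T x xt y yt z zt.

Let sX : sym_form ipX := proj1 pX.
Let sY : sym_form ipY := proj1 pY.
Let sZ : sym_form ipZ := proj1 pZ.
Let pV := ipV_pd_form pX pY pZ.
Let qS := psd_form_op sY S_psd.
Let qT := psd_form_op sZ T_psd.
Let rho0 : rho != 0. Proof. by case/andP: rho_bnd => /gt_eqF ->. Qed.
Let sigma0 : sigma != 0. Proof. by rewrite gt_eqF. Qed.

Local Notation ip := (ipV ipX ipY ipZ).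
Local Notation XiO := (Xi A As B Bs sigma rho S T Sigf Sigg).
Local Notation Phi v := (ip v (XiO v)).
Local Notation nu := (nu_seq x y yt z zt).
Local Notation u k := (yt k - y k).
Local Notation w k := (zt k - z k).
Local Notation resid k := (As (y k) + Bs (z k) - c).
Local Notation dAy k := (As (y k.+1 - y k)).

(** * Recursions and optimality conditions of the iterates *)

Lemma pGADMM_x k : x k = xt k - sigma *: (As (y k) + Bs (zt k.+1) - c).
Proof. by case: gen => _ _ _ x0 H; case: k => // k; have [_ []] := H k.+1 erefl. Qed.

Lemma pGADMM_ysubdiff k : subdiff ipY f (y k) (A (x k) + S (yt k - y k)).
Proof.
have ymin : is_argmin (ystep_obj ipX ipY f As Bs c sigma S (zt k.+1) (xt k) (yt k)) (y k).
  by case: gen => _ _ y0 _ H; case: k => // k; have [_ []] := H k.+1 erefl.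
rewrite pGADMM_x -addrA.
apply: (argmin_step_subdiff pX pY f_cpc A_adj S_psd) => v.
have := ymin v; rewrite /ystep_obj /auglag /= !adde0 -!addeA -!EFinD.
by rewrite -!(addrA (As _)).
Qed.

Lemma pGADMM_zsubdiff k : subdiff ipZ g (z k.+1)
  (B (x k - sigma *: (As (y k) + Bs (z k.+1) - c)) + T (zt k.+1 - z k.+1)).
Proof.
have zmin : is_argmin (zstep_obj ipX ipZ f g As Bs c sigma T (y k) (x k) (zt k.+1)) (z k.+1).
  by case: gen => _ _ _ _ H; have [] := H k.+1 erefl.
(* The [z]-objective contains [f (y k)]; its finiteness, known from the [y]-step, allows it to be
   cancelled. *)
have [a fy] := edomP f_cpc (proj1 (pGADMM_ysubdiff k)).
have swap v : As (y k) + Bs v - c = Bs v + (As (y k) - c).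
  by rewrite addrAC addrC.
rewrite swap.
apply: (argmin_step_subdiff pX pZ g_cpc B_adj T_psd) => v.
have := zmin v; rewrite /zstep_obj /auglag /= fy !swap -!addeA -!EFinD.
by rewrite leeD2lE.
Qed.

Lemma pGADMM_u k :
  yt k.+1 - y k.+1 = (1 - rho) *: (yt k - y k) + y k - y k.+1.
Proof.
case: gen => _ _ _ _ H; have [_ [-> _ _ _ _]] := H k.+1 erefl.
rewrite /= scalerBl scale1r -(opprB (yt k)) scalerN; congr (_ - _).
by rewrite [RHS]addrAC subrK.
Qed.

Lemma pGADMM_zt k : zt k.+2 = zt k.+1 + rho *: (z k.+1 - zt k.+1).
Proof. by case: gen => _ _ _ _ H; have [_ []] := H k.+1 erefl. Qed.

Lemma pGADMM_w k :
  zt k.+2 - z k.+2 = (1 - rho) *: (zt k.+1 - z k.+1) + z k.+1 - z k.+2.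
Proof.
rewrite pGADMM_zt scalerBl scale1r -(opprB (zt k.+1)) scalerN; congr (_ - _).
by rewrite [RHS]addrAC subrK.
Qed.

(** The relaxed points disappear: [x] and [z] are relaxed with the same [rho], so the [zt]
    contributions cancel. *)
Lemma pGADMM_dx k : x k.+1 = x k
  + ((1 - rho) * sigma) *: (As (y k) + Bs (z k.+1) - c)
  - sigma *: (As (y k.+1) + Bs (z k.+1) - c).
Proof.
have xtS : xt k.+1 = xt k + rho *: (x k - xt k).
  by case: gen => _ _ _ _ H; have [_ []] := H k.+1 erefl.
have xtE : xt k = x k + sigma *: (As (y k) + Bs (zt k.+1) - c).
  by rewrite pGADMM_x subrK.
rewrite pGADMM_x xtS pGADMM_zt xtE.
rewrite [Bs (_ + _)]linearD /= [Bs (_ *: _)]linearZ /= [Bs (_ - _)]linearB /=.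
move: (Bs _) (Bs _) => b1 b2.
vect_ring.
Qed.

(** * The [Xi]-form in coordinates and its descent *)

Lemma Xi_formE (a : X) (b d : Y) (e h : Z) :
  ip (a, b, d, e, h) (XiO (a, b, d, e, h)) =
    quad2 (sigma * rho)^-1 ((1 - rho) / rho) (sigma / rho) ipX a (As b)
  + quad2 rho^-1 ((1 - rho) / rho) rho^-1 (fun v v' => ipY v (S v')) b d
  + quad2 rho^-1 ((1 - rho) / rho) ((1 - rho) ^+ 2 / rho)
      (fun v v' => ipZ v (T v')) e h
  + 2 * ipY b (Sigf b) + 2 * ipZ e (Sigg e)
  + (2 - rho) * sigma / 2 * ipX (As b + Bs e) (As b + Bs e).
Proof.
rewrite XiE /Xi_fun /Xi_block /vtheta /vtheta_adj /=.
rewrite !scaler0 !addr0 /quad2.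
have AyE v v' : ipY v (A v') = ipX (As v) v' by rewrite (formC sY) A_adj (formC sX).
have BzE v v' : ipZ v (B v') = ipX (Bs v) v' by rewrite (formC sZ) B_adj (formC sX).
rewrite !(formE sX) !(formE sY) !(formE sZ) !AyE !BzE !(formE sX).
rewrite -[ipY d (S b)](proj1 S_psd) (formC sY (S d) b).
rewrite -[ipZ h (T e)](proj1 T_psd) (formC sZ (T h) e).
rewrite (formC sX (As b) a) (formC sX (Bs e) (As b)).
by field; rewrite rho0 sigma0.
Qed.

Lemma resid_kkt (ys : Y) (zs : Z) (b : Y) (e : Z) : As ys + Bs zs - c = 0 ->
  As b + Bs e - c = As (b - ys) + Bs (e - zs).
Proof.
by move=> /subr0_eq <-; rewrite !linearB /= opprD addrACA.
Qed.

(** Monotonicity against the solution absorbs the inner products left by the block identities.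
    Monotonicity between consecutive [y]-subgradients trades the old [S]-square of [yt - y] and the
    mixed residual for quantities at the new index. The earlier index is at least 1, since [nu 0]
    would involve the meaningless [z 0] and [zt 0]. *)
Lemma Xi_form_descent k nus : Theta ipY ipZ f g A As B Bs c nus ->
  (2 - rho) * (ipY (u k.+2) (S (u k.+2)) + ipZ (w k.+2) (T (w k.+2))
     + sigma / 2 * ipX (resid k.+2) (resid k.+2)
     + sigma / rho * (2 - rho) * ipX (dAy k.+1) (dAy k.+1))
  <= Phi (nu k.+1 - nus) - Phi (nu k.+2 - nus).
Proof.
move=> [xs [ys [zs [[subf subg kkt] ->]]]].
have nuB n : nu n - (xs, ys, 0, zs, 0) =
    (x n - xs, y n - ys, u n, z n - zs, w n) :> kkt_space X Y Z.
  by rewrite -[u n]subr0 -[w n]subr0.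
rewrite !nuB !Xi_formE {nuB}.
have yf n := pGADMM_ysubdiff n.
have zg n := pGADMM_zsubdiff n.
have m1 := subdiff_monotone_ge0 Sigf_psd Sigf_mon subf (yf k.+2).
have m2 := subdiff_monotone_ge0 Sigg_psd Sigg_mon subg (zg k.+1).
have m3 := subdiff_monotone_ge0 Sigf_psd Sigf_mon (yf k.+1) (yf k.+2).
have uE := pGADMM_u k.+1; have wE := pGADMM_w k.
have xE := pGADMM_dx k.+1.
have dy : y k.+2 - y k.+1 = (y k.+2 - ys) - (y k.+1 - ys).
  by rewrite opprB addrA subrK.
have dx : x k.+2 - x k.+1 = (x k.+2 - xs) - (x k.+1 - xs).
  by rewrite opprB addrA subrK.
move: m1 m2 m3 uE wE xE; rewrite !(resid_kkt _ _ kkt) dy.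
have -> : A (x k.+2) + S (u k.+2) - A xs = A (x k.+2 - xs) + S (u k.+2).
  by rewrite addrAC -linearB.
have -> (d : Z) v : B (x k.+1 - v) + T d - B xs = B (x k.+1 - xs - v) + T d.
  by rewrite addrAC -linearB /= [X in B X]addrAC.
have -> : A (x k.+2) + S (u k.+2) - (A (x k.+1) + S (u k.+1)) =
    A (x k.+2 - xs - (x k.+1 - xs)) + S (u k.+2 - u k.+1).
  by rewrite -dx opprD addrACA -!linearB.
move=> m1 m2 m3 uE wE xE; have [r0 r2] := andP rho_bnd.
have {uE} uE : u k.+2 = (1 - rho) *: u k.+1 + (y k.+1 - ys) - (y k.+2 - ys).
  by rewrite uE; vect_ring.
have {wE} wE : w k.+2 = (1 - rho) *: w k.+1 + (z k.+1 - zs) - (z k.+2 - zs).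
  by rewrite wE; vect_ring.
have {xE} xE : x k.+2 - xs = x k.+1 - xs
    + ((1 - rho) * sigma) *: (As (y k.+1 - ys) + Bs (z k.+2 - zs))
    - sigma *: (As (y k.+2 - ys) + Bs (z k.+2 - zs)).
  by rewrite xE; vect_ring.
have Y1 := quad2_relax (proj1 qS) rho0 uE.
have Z1 := quad2_relax_swap (proj1 qT) rho0 wE.
have X1 := quad2_multiplier sX rho0 sigma0 xE.
set h := As (y k.+1 - ys) in X1 xE m2 *; set h' := As (y k.+2 - ys) in X1 xE *.
set gg := Bs (z k.+2 - zs) in X1 xE m2 *.
(* The increment of [x] is [- rho sigma (h + gg) - sigma (h' - h)], which gives the inequality the
   shape expected by [quad2_successive]. *)
have {}m3 : 0 <= - rho * (sigma * ipX (h + gg) (h' - h))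
    - sigma * ipX (h' - h) (h' - h)
    + ipY (u k.+2 - u k.+1) (S (y k.+2 - ys - (y k.+1 - ys))).
  apply: le_trans (_ : _ <= ipY (y k.+2 - ys - (y k.+1 - ys)) _) _.
    by case: Sigf_psd => _; apply.
  apply: le_trans m3 _; rewrite (formDl sY) A_adj (proj1 S_psd).
  rewrite [As (_ - _)]linearB /= -/h -/h'.
  rewrite (_ : x k.+2 - xs - (x k.+1 - xs) =
    - ((rho * sigma) *: (h + gg)) - sigma *: (h' - h)); last first.
    by rewrite xE; vect_ring.
  by rewrite (formDl sX) !(formNl sX) !(formZl sX) !mulNr !mulrA.
have U1 := quad2_successive (proj1 qS) rho0 rho_bnd qS uE m3.
have {}m1 : ipY (y k.+2 - ys) (Sigf (y k.+2 - ys)) <=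
    ipX (x k.+2 - xs) h' + ipY (u k.+2) (S (y k.+2 - ys)).
  by rewrite (le_trans m1) // (formDl sY) A_adj (proj1 S_psd).
have {}m2 : ipZ (z k.+2 - zs) (Sigg (z k.+2 - zs)) <=
    ipX (x k.+1 - xs - sigma *: (h + gg)) gg + ipZ (w k.+2) (T (z k.+2 - zs)).
  by rewrite (le_trans m2) // (formDl sZ) B_adj (proj1 T_psd).
(* At the earlier index the [Sigf], [Sigg] and [vtheta] terms are only kept nonnegative. At the
   later one [m1] and [m2] absorb the first two, and [X1] with [U1] pays for the third. *)
have s1 : 0 <= ipY (y k.+1 - ys) (Sigf (y k.+1 - ys)) by case: Sigf_psd => _; apply.
have s2 : 0 <= ipZ (z k.+1 - zs) (Sigg (z k.+1 - zs)) by case: Sigg_psd => _; apply.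
have s3 : 0 <= (2 - rho) * sigma / 2 * ipX (h + Bs (z k.+1 - zs)) (h + Bs (z k.+1 - zs)).
  rewrite mulr_ge0 ?(proj2 (pd_form_psd pX)) // divr_ge0 // mulr_ge0 ?(ltW sigma_gt0) //.
  by lra.
have U2 := ler_wpM2l (_ : 0 <= 2 - rho) U1.
have {}U2 := U2 ltac:(lra).
have -> : As (y k.+2 - ys - (y k.+1 - ys)) = h' - h by rewrite linearB.
have -> : sigma / rho * (2 - rho) = 2 / rho * sigma - sigma by field.
move: U2 Y1 Z1 X1 s1 s2 s3 m1 m2 {m3 U1 uE wE xE} => /=.
rewrite -mulrA.
move: (quad2 _ _ _ _ _ _) (quad2 _ _ _ _ _ _) => q1 q2.
move: (quad2 _ _ _ _ _ _) (quad2 _ _ _ _ _ _) => q3 q4.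
move: (quad2 _ _ _ _ _ _) (quad2 _ _ _ _ _ _) => q5 q6.
rewrite !(formE sX) (formC sX h' h) (formC sX gg h) (formC sX gg h').
move: (ipX _ h') (ipX _ h') (ipX _ gg) (ipX _ gg) (rho^-1) => a1 a2 a3 a4 ri.
by lra.
Qed.

(** * Bounding the KKT residual *)

Lemma form_B_le_lambda_max v :
  ipZ (B v) (B v) <= lambda_max (Bs \o B)%VF * ipX v v.
Proof.
have BsB a b : ipX a ((Bs \o B)%VF b) = ipZ (B a) (B b).
  by rewrite comp_lfunE B_adj.
rewrite -BsB; apply: (form_le_lambda_max pX) => a b.
by rewrite BsB (formC sX) BsB (formC sZ).
Qed.

(** Rewriting the [z]-step condition around the new multiplier creates the coefficients
    [(2 - rho) * sigma] and [(1 - rho) * sigma] whose squares appear in [kappa]. *)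
Lemma pGADMM_zsubdiff_next k : subdiff ipZ g (z k.+2)
  (B (x k.+2 + ((2 - rho) * sigma) *: dAy k.+1 - ((1 - rho) * sigma) *: resid k.+2)
   + T (w k.+2)).
Proof.
have := pGADMM_zsubdiff k.+1.
congr (subdiff _ _ _ (B _ + _)); rewrite (pGADMM_dx k.+1) [As (_ - _)]linearB /=.
by move: (As _) (As _) (Bs _) (x _) => *; vect_ring.
Qed.

(** By [prox_residual], the [y]-component is controlled by [S u] and the [z]-component by three
    errors, namely [T w] and the two terms of [pGADMM_zsubdiff_next]. The first component is the
    primal residual itself and accounts for the [+ 1] in [kappa]. *)
Lemma kkt_map_bound k :
  ip (kkt_map ipY ipZ f g A As B Bs c (nu k.+2))
     (kkt_map ipY ipZ f g A As B Bs c (nu k.+2))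
  <= kappa ipY ipZ B Bs sigma rho S T *
     (ipY (u k.+2) (S (u k.+2)) + ipZ (w k.+2) (T (w k.+2))
      + ipX (resid k.+2) (resid k.+2) + ipX (dAy k.+1) (dAy k.+1)).
Proof.
rewrite /kkt_map /nu_seq /ipV /= (form0l sY) (form0l sZ) !addr0.
set kap := kappa _ _ _ _ _ _ _ _; set lam := lambda_max (Bs \o B)%VF.
have yf := pGADMM_ysubdiff k.+2.
have zg := pGADMM_zsubdiff_next k.
move: (resid _) (dAy _) zg => r a zg.
have ky : ipY (y k.+2 - prox ipY f (y k.+2 + A (x k.+2)))
              (y k.+2 - prox ipY f (y k.+2 + A (x k.+2)))
          <= opnorm ipY S * ipY (u k.+2) (S (u k.+2)).
  apply: le_trans (form_op_le_opnorm pY _ S_psd).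
  have := prox_residual pY f_cpc (S (u k.+2)) yf.
  by rewrite -addrA addrK.
set v1 := B (((2 - rho) * sigma) *: a); set v2 := B (((1 - rho) * sigma) *: r).
have kz : ipZ (z k.+2 - prox ipZ g (z k.+2 + B (x k.+2)))
              (z k.+2 - prox ipZ g (z k.+2 + B (x k.+2)))
          <= 3 * (ipZ (T (w k.+2)) (T (w k.+2)) + ipZ v1 v1 + ipZ v2 v2).
  have := prox_residual pZ g_cpc (T (w k.+2) + v1 - v2) zg.
  have -> : z k.+2 + (B (x k.+2 + ((2 - rho) * sigma) *: a
      - ((1 - rho) * sigma) *: r) + T (w k.+2))
      - (T (w k.+2) + v1 - v2) = z k.+2 + B (x k.+2).
    rewrite [B (_ - _)]linearB /= [B (_ + _)]linearD /= -/v1 -/v2.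
    by move: (B (x _)) v1 v2 (T _) => b b1 b2 t; vect_ring.
  move=> /le_trans; apply.
  have := form_sqD3 (T (w k.+2)) v1 (- v2) (pd_form_psd pZ).
  by rewrite (formNl sZ v2) (formNr sZ v2) opprK.
have kT := form_op_le_opnorm pZ (w k.+2) T_psd.
have k1 : ipZ v1 v1 <= (2 - rho) ^+ 2 * sigma ^+ 2 * lam * ipX a a.
  rewrite (le_trans (form_B_le_lambda_max _)) // (formZl sX) (formZr sX) -/lam.
  by rewrite le_eqVlt; apply/orP; left; apply/eqP; ring.
have k2 : ipZ v2 v2 <= (1 - rho) ^+ 2 * sigma ^+ 2 * lam * ipX r r.
  rewrite (le_trans (form_B_le_lambda_max _)) // (formZl sX) (formZr sX) -/lam.
  by rewrite le_eqVlt; apply/orP; left; apply/eqP; ring.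
have Su0 : 0 <= ipY (u k.+2) (S (u k.+2)) by case: S_psd => _; apply.
have Tw0 : 0 <= ipZ (w k.+2) (T (w k.+2)) by case: T_psd => _; apply.
have a0 : 0 <= ipX a a by case: (pd_form_psd pX) => _; apply.
have r0 : 0 <= ipX r r by case: (pd_form_psd pX) => _; apply.
have [b1 b2 b3 b4] : [/\ opnorm ipY S <= kap, 3 * opnorm ipZ T <= kap,
    3 * (2 - rho) ^+ 2 * sigma ^+ 2 * lam <= kap &
    3 * (1 - rho) ^+ 2 * sigma ^+ 2 * lam + 1 <= kap].
  by split; rewrite /kap /kappa !le_max -/lam lexx ?orbT.
have := ler_wpM2r Su0 b1; have := ler_wpM2r Tw0 b2.
have := ler_wpM2r a0 b3; have := ler_wpM2r r0 b4.
move: ky kz kT k1 k2.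
move: (kap) (lam) (opnorm _ _) (opnorm _ _) => K L N1 N2.
move: (ipY _ _) (ipY _ _) (ipZ _ _) (ipZ v1 v1) (ipZ v2 v2) => *.
by lra.
Qed.

(** * Semidefiniteness and kernel of [Xi] *)

Lemma Xi_self_adjoint : self_adjoint ip XiO.
Proof.
move=> [[[[a b] d] e] h] [[[[a' b'] d'] e'] h'].
rewrite !XiE /Xi_fun /Xi_block /vtheta /vtheta_adj /= !scaler0 !addr0.
have AyE v v' : ipY v (A v') = ipX (As v) v' by rewrite (formC sY) A_adj (formC sX).
have BzE v v' : ipZ v (B v') = ipX (Bs v) v' by rewrite (formC sZ) B_adj (formC sX).
rewrite !(formE sX) !(formE sY) !(formE sZ) !A_adj !B_adj !AyE !BzE.
rewrite !(proj1 S_psd) !(proj1 T_psd) !(proj1 Sigf_psd) !(proj1 Sigg_psd) !(formE sX).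
by ring.
Qed.

Lemma Xi_form_lower (a : X) (b d : Y) (e h : Z) :
  quad2 (sigma * rho)^-1 ((1 - rho) / rho) (sigma / rho) ipX a (As b)
  + quad2 (1 * rho)^-1 ((1 - rho) / rho) (1 / rho) (fun v v' => ipY v (S v')) b d
  + rho^-1 * ipZ (e + (1 - rho) *: h) (T (e + (1 - rho) *: h))
  <= Phi (a, b, d, e, h).
Proof.
rewrite Xi_formE // mul1r div1r -(quad2_swap_square e h rho0 (proj1 qT)).
have h4 : 0 <= 2 * ipY b (Sigf b).
  by rewrite mulr_ge0 //; case: Sigf_psd => _; apply.
have h5 : 0 <= 2 * ipZ e (Sigg e).
  by rewrite mulr_ge0 //; case: Sigg_psd => _; apply.
have h6 : 0 <= (2 - rho) * sigma / 2 * ipX (As b + Bs e) (As b + Bs e).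
  have [r0 r2] := andP rho_bnd.
  rewrite mulr_ge0 ?(proj2 (pd_form_psd pX)) // divr_ge0 // mulr_ge0 ?(ltW sigma_gt0) //.
  by rewrite subr_ge0 ltW.
move: (quad2 _ _ _ _ _ _) (quad2 _ _ _ _ _ _) (quad2 _ _ _ _ _ _) => q1 q2 q3.
by lra.
Qed.

Lemma Xi_form_lower_ge0 (a : X) (b d : Y) (e h : Z) :
  [/\ 0 <= quad2 (sigma * rho)^-1 ((1 - rho) / rho) (sigma / rho) ipX a (As b),
      0 <= quad2 (1 * rho)^-1 ((1 - rho) / rho) (1 / rho)
             (fun v v' => ipY v (S v')) b d &
      0 <= rho^-1 * ipZ (e + (1 - rho) *: h) (T (e + (1 - rho) *: h))].
Proof.
split; first exact: quad2_ge0 (pd_form_psd pX).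
  exact: quad2_ge0 qS.
have [r0 _] := andP rho_bnd.
by rewrite mulr_ge0 ?invr_ge0 ?(ltW r0) //; case: T_psd => _; apply.
Qed.

Lemma Xi_form_ge0 v : 0 <= Phi v.
Proof.
case: v => [[[[a b] d] e] h]; apply: le_trans (Xi_form_lower a b d e h).
have [h1 h2 h3] := Xi_form_lower_ge0 a b d e h.
exact: (addr_ge0 (addr_ge0 h1 h2) h3).
Qed.

Hypothesis S_pos : forall v, v != 0 -> 0 < ipY v (S v).
Hypothesis T_pos : forall v, v != 0 -> 0 < ipZ v (T v).
Let pS : pd_form (fun v v' => ipY v (S v')).
Proof. by split; [case: qS|exact: S_pos]. Qed.
Let pT : pd_form (fun v v' => ipZ v (T v')).
Proof. by split; [case: qT|exact: T_pos]. Qed.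

Lemma Xi_form_kernel (a : X) (b d : Y) (e h : Z) : Phi (a, b, d, e, h) <= 0 ->
  [/\ a = 0, b = 0, d = 0 & e + (1 - rho) *: h = 0].
Proof.
have [h1 h2 h3] := Xi_form_lower_ge0 a b d e h.
move=> /(le_trans (Xi_form_lower a b d e h)) le0.
have [r0 _] := andP rho_bnd.
have [-> _] := quad2_eq0 rho_bnd sigma_gt0 pX (ltac:(lra) : quad2 _ _ _ _ a (As b) <= 0).
have [-> ->] := quad2_eq0 rho_bnd ltr01 pS (ltac:(lra) : quad2 _ _ _ _ b d <= 0).
split=> //; apply: (pd_form_eq0 pT).
by rewrite -(pmulr_rle0 _ (_ : 0 < rho^-1)) ?invr_gt0 //; lra.
Qed.

(* [Xi] alone is degenerate on the last component, e.g. when [rho = 1]. *)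
Lemma Xi_coercive : pd_form (fun v v' => ip v (XiO v') + ipZ v.2 (T v'.2)).
Proof.
have [sV _] := ipV_pd_form pX pY pZ.
split.
  apply: sym_formD; first exact: form_op sV Xi_self_adjoint.
  split=> [v v'|r v v' v2]; first by rewrite -(proj1 T_psd) (formC sZ).
  by rewrite /= (formPl sZ).
move=> v; apply: contraNT; rewrite -leNgt.
case: v => [[[[a b] d] e] h]; rewrite [(_, h).2]/= => le0.
have T0 : 0 <= ipZ h (T h) by case: T_psd => _; apply.
have Phi0 := Xi_form_ge0 (a, b, d, e, h).
have h0 : h = 0 by apply: (pd_form_eq0 pT); lra.
have /Xi_form_kernel [-> -> ->] : Phi (a, b, d, e, h) <= 0 by lra.
by rewrite h0 scaler0 addr0 => ->.
Qed.

(** On the zero space [lambda_max Xi] is 0, its inverse is 0 by convention, so [beta = 0] and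
    [alpha = 1], leaving no room for [zeta]. Nonzero dimension excludes this. *)
Lemma lambda_max_Xi_gt0 : (0 < \dim {: kkt_space X Y Z})%N ->
  0 < lambda_max XiO.
Proof.
move=> dimV; rewrite ltNge; apply/negP => le0.
have Phi0 v : Phi v <= 0.
  apply: le_trans (form_le_lambda_max pV v Xi_self_adjoint) _.
  by rewrite mulr_le0_ge0 // (proj2 (pd_form_psd pV)).
suff V0 (v : kkt_space X Y Z) : v = 0.
  move: dimV; rewrite lt0n dimv_eq0 -vpick0 [vpick _]V0 eqxx //.
case: v => [[[[a b] d] e] h].
have [-> -> -> _] := Xi_form_kernel (Phi0 (a, b, d, e, h)).
(* The kernel only constrains [e + (1 - rho) *: h]; testing with each vector alone in the [z]-slot
   separates the two. *)
have [_ _ _] := Xi_form_kernel (Phi0 (0, 0, 0, e, 0)).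
rewrite scaler0 addr0 => ->.
have [_ _ _] := Xi_form_kernel (Phi0 (0, 0, 0, h, 0)).
by rewrite scaler0 addr0 => ->.
Qed.

(** * Convergence of the whole sequence *)

Local Notation TH := (Theta ipY ipZ f g A As B Bs c).
Local Notation drop k := ((2 - rho) *
  (ipY (u k.+2) (S (u k.+2)) + ipZ (w k.+2) (T (w k.+2))
   + sigma / 2 * ipX (resid k.+2) (resid k.+2)
   + sigma / rho * (2 - rho) * ipX (dAy k.+1) (dAy k.+1))).

Lemma drop_lower : exists2 C : R, 0 < C & forall k,
  [/\ ipY (u k.+2) (u k.+2) <= C * drop k,
      ipZ (w k.+2) (w k.+2) <= C * drop k,
      ipZ (w k.+2) (T (w k.+2)) <= C * drop k,
      ipX (resid k.+2) (resid k.+2) <= C * drop k &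
      ipX (dAy k.+1) (dAy k.+1) <= C * drop k].
Proof.
have [r0 r2] := andP rho_bnd; have r2' : 0 < 2 - rho by rewrite subr_gt0.
have [C1 C10 h1] := form_bounded pS sY.
have [C2 C20 h2] := form_bounded pT sZ.
have s2 : 0 < sigma / 2 by rewrite divr_gt0.
have s3 : 0 < sigma / rho * (2 - rho) by rewrite mulr_gt0 // divr_gt0.
pose D := C1 + C2 + 1 + (sigma / 2)^-1 + (sigma / rho * (2 - rho))^-1.
have D0 : 0 < D by rewrite /D !addr_gt0 ?invr_gt0.
exists (D / (2 - rho)) => [|k]; first by rewrite divr_gt0.
have a1 : 0 <= ipY (u k.+2) (S (u k.+2)) by case: S_psd => _; apply.
have a2 : 0 <= ipZ (w k.+2) (T (w k.+2)) by case: T_psd => _; apply.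
have a3 : 0 <= ipX (resid k.+2) (resid k.+2) by case: (pd_form_psd pX) => _; apply.
have a4 : 0 <= ipX (dAy k.+1) (dAy k.+1) by case: (pd_form_psd pX) => _; apply.
have := h1 (u k.+2); have := h2 (w k.+2); rewrite /=.
rewrite mulrA divfK ?gt_eqF //.
move: (ipY _ (S _)) a1 (ipZ _ (T _)) a2 => t1 a1 t2 a2 b2 b1.
move: (ipX _ _) a3 (ipX _ _) a4 => t3 a3 t4 a4.
move: (sigma / 2) s2 (sigma / rho * (2 - rho)) s3 @D D0 => s s0 s' s'0 D D0.
have key C t : 0 < C -> C <= D -> 0 <= t -> t <= t1 + t2 + s * t3 + s' * t4 ->
    C * t <= D * (t1 + t2 + s * t3 + s' * t4).
  by move=> C0 CD t0 tl; rewrite ler_pM // ltW.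
have st3 : 0 <= s * t3 by rewrite mulr_ge0 // ltW.
have st4 : 0 <= s' * t4 by rewrite mulr_ge0 // ltW.
have si : 0 < s^-1 by rewrite invr_gt0.
have s'i : 0 < s'^-1 by rewrite invr_gt0.
have k1 := key C1 t1 C10 ltac:(rewrite /D; lra) a1 ltac:(lra).
have k2 := key C2 t2 C20 ltac:(rewrite /D; lra) a2 ltac:(lra).
have k3 := key 1 t2 ltr01 ltac:(rewrite /D; lra) a2 ltac:(lra).
have k4 := key s^-1 (s * t3) si ltac:(rewrite /D; lra) st3 ltac:(lra).
have k5 := key s'^-1 (s' * t4) s'i ltac:(rewrite /D; lra) st4 ltac:(lra).
move: k4 k5; rewrite !mulKf ?gt_eqF // => k4 k5.
rewrite mul1r in k3.
by split=> //; [exact: le_trans k1|exact: le_trans k2].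
Qed.

Lemma drop_ge0 k : 0 <= drop k.
Proof.
have [C C0 /(_ k) [h _ _ _ _]] := drop_lower.
by rewrite -(pmulr_rge0 _ C0); apply: le_trans h; case: (pd_form_psd pY) => _; apply.
Qed.

Lemma drop_small nus : TH nus -> forall e : R, 0 < e ->
  exists N, forall k, (N <= k)%N -> drop k < e.
Proof.
move=> Ts; apply: (@telescoping_small _ (fun k => Phi (nu k.+1 - nus))) => k.
- exact: Xi_form_ge0.
- exact: drop_ge0.
- exact: Xi_form_descent.
Qed.

Lemma Phi_antitone nus : TH nus ->
  forall m n, (m <= n)%N -> Phi (nu n.+1 - nus) <= Phi (nu m.+1 - nus).
Proof.
move=> Ts m; elim=> [|n IH]; first by rewrite leqn0 => /eqP ->.
rewrite leq_eqVlt => /orP[/eqP ->//|/IH]; apply: le_trans.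
rewrite -subr_ge0; apply: le_trans (drop_ge0 n) _.
exact: Xi_form_descent.
Qed.

Lemma cluster_Theta nus nub : TH nus ->
  (forall (e : R) N, 0 < e ->
     exists2 k, (N <= k)%N & ip (nu k.+2 - nub) (nu k.+2 - nub) < e) ->
  TH nub.
Proof.
move=> Ts; case: nub => [[[[x0 y0] u0] z0] w0] cl.
have [C C0 dl] := drop_lower.
have close (e : R) : 0 < e -> exists k,
    [/\ ipX (x k.+2 - x0) (x k.+2 - x0) <= e, ipY (y k.+2 - y0) (y k.+2 - y0) <= e,
        ipY (u k.+2 - u0) (u k.+2 - u0) <= e, ipZ (z k.+2 - z0) (z k.+2 - z0) <= e &
        ipZ (w k.+2 - w0) (w k.+2 - w0) <= e] /\
    [/\ ipY (u k.+2) (u k.+2) <= e, ipZ (w k.+2) (w k.+2) <= e,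
        ipX (resid k.+2) (resid k.+2) <= e & ipX (dAy k.+1) (dAy k.+1) <= e].
  move=> e0; have [N dN] := drop_small Ts (divr_gt0 e0 C0).
  have [k Nk lt] := cl e N e0; exists k.
  have [d1 d2 d3 d4 d5] := dl k.
  have dk : C * drop k <= e by rewrite mulrC -ler_pdivlMr // ltW // dN.
  split; last first.
    by split; apply: le_trans dk.
  have [l1 l2 l3 l4 l5] := ipV_components (x k.+2 - x0) (y k.+2 - y0)
    (u k.+2 - u0) (z k.+2 - z0) (w k.+2 - w0) pX pY pZ.
  by split; apply: ltW; apply: le_lt_trans lt.
have u00 : u0 = 0.
  (* The 4 arises from writing [u0] as [u] minus [u - u0], both of square at most [e], and doubling
     their sum. *)
  apply: (pd_form_eq0 pY); apply: (@le0_of_le_mule _ _ 4) => // e e0.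
  have [k [[_ _ h _ _] [h' _ _ _]]] := close e e0.
  have := form_sqD2 (u k.+2) (- (u k.+2 - u0)) (pd_form_psd pY).
  rewrite (formNl sY (u _ - _)) (formNr sY (u _ - _)) opprK opprB subrKC.
  by lra.
have w00 : w0 = 0.
  apply: (pd_form_eq0 pZ); apply: (@le0_of_le_mule _ _ 4) => // e e0.
  have [k [[_ _ _ _ h] [_ h' _ _]]] := close e e0.
  have := form_sqD2 (w k.+2) (- (w k.+2 - w0)) (pd_form_psd pZ).
  rewrite (formNl sZ (w _ - _)) (formNr sZ (w _ - _)) opprK opprB subrKC.
  by lra.
exists x0, y0, z0; split; last by rewrite u00 w00.
have [CA CA0 hA] := linear_bounded A pX sY.
have [CAs CAs0 hAs] := linear_bounded As pY sX.
have [CB CB0 hB] := linear_bounded B pX sZ.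
have [CBs CBs0 hBs] := linear_bounded Bs pZ sX.
have [CS CS0 hS] := linear_bounded S pY sY.
have [CT CT0 hT] := linear_bounded T pZ sZ.
have CM (C' t e : R) : 0 < C' -> t <= e -> C' * t <= C' * e.
  by move=> C'0; rewrite ler_pM2l.
split.
- apply: (subdiff_closed pY f_cpc) => e e0.
  have KK : 0 < 2 * (CA + CS) by rewrite mulr_gt0 // addr_gt0.
  have [d d0 dK] := exists_scaled_lt_sqr KK e0.
  have [k [[h1 h2 _ _ _] [h3 _ _ _]]] := close d d0.
  have Kd : 0 <= 2 * (CA + CS) * d by rewrite ltW // mulr_gt0.
  exists (y k.+2), (A (x k.+2) + S (u k.+2)); split.
  + exact: (pGADMM_ysubdiff k.+2).
  + apply: enorm_lt (pd_form_psd pY) e0 _; lra.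
  + apply: enorm_lt (pd_form_psd pY) e0 _.
    rewrite addrAC -linearB; apply: le_lt_trans (form_sqD2 _ _ (pd_form_psd pY)) _.
    have := hA (x k.+2 - x0); have := hS (u k.+2).
    have := CM _ _ _ CA0 h1; have := CM _ _ _ CS0 h3.
    by lra.
- apply: (subdiff_closed pZ g_cpc) => e e0.
  have := pGADMM_zsubdiff_next.
  move: ((2 - rho) * sigma) ((1 - rho) * sigma) => s1 s2 zsub.
  pose K := 3 * (CB + 2 * CB * (s1 ^+ 2 + s2 ^+ 2) + CT).
  have s0 : 0 <= 2 * CB * (s1 ^+ 2 + s2 ^+ 2).
    by rewrite mulr_ge0 ?addr_ge0 ?sqr_ge0 // mulr_ge0 // ltW.
  have KK : 0 < K by rewrite /K; lra.
  have [d d0 dK] := exists_scaled_lt_sqr KK e0.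
  have [k [[h1 _ _ h2 _] [_ h3 h4 h5]]] := close d d0.
  have Kd : 0 <= K * d by rewrite ltW // mulr_gt0.
  exists (z k.+2), (B (x k.+2 + s1 *: dAy k.+1 - s2 *: resid k.+2) + T (w k.+2)); split.
  + exact: zsub.
  + apply: enorm_lt (pd_form_psd pZ) e0 _; lra.
  + apply: enorm_lt (pd_form_psd pZ) e0 _.
    have split3 (a b q : X) (t : Z) : B (a + q) + t - B b = B (a - b) + B q + t.
      by rewrite linearD linearB /= addrAC; congr (_ + _); rewrite addrAC.
    rewrite -[x k.+2 + _ - _]addrA split3.
    apply: le_lt_trans (form_sqD3 _ _ _ (pd_form_psd pZ)) _.
    have := hB (x k.+2 - x0); have := hT (w k.+2).
    have := hB (s1 *: dAy k.+1 - s2 *: resid k.+2).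
    have := form_sqD2 (s1 *: dAy k.+1) (- (s2 *: resid k.+2)) (pd_form_psd pX).
    rewrite (formNl sX (s2 *: _)) (formNr sX (s2 *: _)) opprK.
    rewrite (formZl sX s1) (formZr sX s1) (formZl sX s2) (formZr sX s2).
    have := CM _ _ _ CB0 h1; have := CM _ _ _ CT0 h3.
    have := ler_wpM2l (sqr_ge0 s1) h5; have := ler_wpM2l (sqr_ge0 s2) h4.
    rewrite !expr2 !mulrA => i1 i2 i3 i4 i5 i6.
    have := CM _ _ _ CB0 i5.
    have := CM _ _ _ CB0 i1; have := CM _ _ _ CB0 i2.
    move: dK; rewrite /K !expr2; lra.
- set r0 := As y0 + Bs z0 - c.
  apply: (pd_form_eq0 pX); apply: (@le0_of_le_mule _ _ (3 * (1 + CAs + CBs))).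
    by lra.
  move=> e e0; have [k [[_ h1 _ h2 _] [_ _ h3 _]]] := close e e0.
  have -> : r0 = resid k.+2 + - As (y k.+2 - y0) + - Bs (z k.+2 - z0).
    by rewrite /r0 !linearB /=; move: (As _) (As _) (Bs _) (Bs _) => *; vect_ring.
  apply: le_trans (form_sqD3 _ _ _ (pd_form_psd pX)) _.
  rewrite !(formNl sX (As _)) !(formNr sX (As _)) !(formNl sX (Bs _)) !(formNr sX (Bs _)).
  have := hAs (y k.+2 - y0); have := hBs (z k.+2 - z0); rewrite !opprK.
  have := CM _ _ _ CAs0 h1; have := CM _ _ _ CBs0 h2.
  by lra.
Qed.


Lemma pGADMM_cvg nus : TH nus -> exists2 nub, TH nub &
  forall e : R, 0 < e -> exists N, forall k, (N <= k)%N ->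
    ip (nu k.+2 - nub) (nu k.+2 - nub) < e.
Proof.
move=> Ts.
have pP := Xi_coercive.
set P := (fun v v' => _) in pP.
have PE th k : TH th ->
    P (nu k - th) (nu k - th) = Phi (nu k - th) + ipZ (w k) (T (w k)).
  by move=> [xs [ys [zs [_ ->]]]]; rewrite -[w k]subr0.
have [C1 C10 ipP] := form_bounded pP (proj1 pV).
have [C C0 dl] := drop_lower.
have wle k e : drop k <= e -> ipZ (w k.+2) (T (w k.+2)) <= C * e.
  have [_ _ h _ _] := dl k => de; apply: le_trans h _.
  by rewrite ler_pM2l.
have anti th := Phi_antitone (nus := th).
(* The [w]-part has no monotonicity of its own, but each drop is at most the initial value of
   [Phi]. *)
have Pbnd k : P (nu k.+2 - nus) (nu k.+2 - nus) <=
    Phi (nu 1%N - nus) + C * Phi (nu 1%N - nus).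
  rewrite PE // lerD ?(anti _ Ts 0%N k.+1) // wle //.
  apply: le_trans (Xi_form_descent k Ts) _; have := anti _ Ts 0%N k (leq0n k).
  by have := Xi_form_ge0 (nu k.+2 - nus); lra.
have [l lcl] := form_bounded_cluster (u := fun k => nu k.+2 - nus) pP Pbnd.
pose nub := nus + l.
have nubE k : nu k.+2 - nus - l = nu k.+2 - nub by rewrite /nub opprD addrA.
have Tb : TH nub.
  apply: (cluster_Theta Ts).
  move=> e N e0; have [k Nk Pk] := lcl _ N (divr_gt0 e0 C10).
  exists k => //; rewrite -nubE; apply: le_lt_trans (ipP _) _.
  by rewrite mulrC -ltr_pdivlMr.
exists nub => // e e0.
have e1 : 0 < e / (2 * C1) by rewrite divr_gt0 // mulr_gt0.
have [k0 _] := lcl _ 0%N e1; rewrite nubE PE // => Pk0.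
have T0 v : 0 <= ipZ v (T v) by case: T_psd => _; apply.
have [N dN] := drop_small Tb
  (divr_gt0 e1 C0).
exists (maxn N k0) => k; rewrite geq_max => /andP[Nk kk].
apply: le_lt_trans (ipP _) _; rewrite PE //.
have h1 : Phi (nu k.+2 - nub) < e / (2 * C1).
  apply: le_lt_trans (anti _ Tb k0.+1 k.+1 kk) _; apply: le_lt_trans Pk0.
  by rewrite lerDl.
(* While [Phi] stays small after one good index [k0], the [w]-part is small only because late drops
   are; hence the threshold [maxn N k0]. *)
have h2 := wle _ _ (ltW (dN k Nk)); rewrite mulrC divfK ?gt_eqF // in h2.
have -> : e = C1 * (e / (2 * C1) + e / (2 * C1)) by field; rewrite gt_eqF.
by rewrite ltr_pM2l // ltr_leD.
Qed.

(** * Calmness and the contraction factor *)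

Local Notation distX v := (distO ip XiO v TH).
Local Notation Rh v := (kkt_map ipY ipZ f g A As B Bs c v).
Local Notation kap := (kappa ipY ipZ B Bs sigma rho S T).

(** The last entry of the maximum is at least 1, whatever [S], [T] and [B] are. *)
Lemma kappa_gt0 : 0 < kap.
Proof.
have BsB a b : ipX a ((Bs \o B)%VF b) = ipZ (B a) (B b).
  by rewrite comp_lfunE B_adj.
have lam0 : 0 <= lambda_max (Bs \o B)%VF.
  apply: (lambda_max_ge0 pX); split=> [a b|a].
    by rewrite BsB (formC sX) BsB (formC sZ).
  by rewrite BsB; case: (pd_form_psd pZ) => _; apply.
rewrite /kappa !lt_max; apply/orP; right; apply/orP; right; apply/orP; right.
apply: ltr_wpDl => //; apply: mulr_ge0 => //.
by apply: mulr_ge0; rewrite ?sqr_ge0 //; apply: mulr_ge0; rewrite ?sqr_ge0.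
Qed.

Hypothesis V_neq0 : (0 < \dim {: kkt_space X Y Z})%N.
Let lamXi_gt0 : 0 < lambda_max XiO.
Proof.
exact: (lambda_max_Xi_gt0 V_neq0).
Qed.

Local Notation bet := (beta ipY ipZ A As B Bs sigma rho S T Sigf Sigg).

Lemma beta_gt0 lambda : 0 < lambda -> 0 < bet lambda.
Proof.
move=> l0; have [r0 r2] := andP rho_bnd; have r2' : 0 < 2 - rho by rewrite subr_gt0.
rewrite /beta mulr_gt0 //; last first.
  by rewrite invr_gt0 !mulr_gt0 ?exprn_gt0 ?kappa_gt0.
by rewrite mulr_gt0 // !lt_min ltr01 !mulr_gt0 ?invr_gt0.
Qed.

(** The terms of the drop carry weights 1, 1, [sigma / 2] and [sigma / rho * (2 - rho)], those of
    [kkt_map_bound] all carry 1; the minimum reconciles them. *)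
Lemma kkt_map_le_drop k :
  (2 - rho) * Num.min 1 (Num.min (sigma / 2) (sigma / rho * (2 - rho))) *
    ip (Rh (nu k.+2)) (Rh (nu k.+2)) <= kap * drop k.
Proof.
have [r0 r2] := andP rho_bnd; have r2' : 0 < 2 - rho by rewrite subr_gt0.
set m := Num.min _ _.
have m0 : 0 < m by rewrite !lt_min ltr01 !mulr_gt0 ?invr_gt0.
have [m1 m2 m3] : [/\ m <= 1, m <= sigma / 2 & m <= sigma / rho * (2 - rho)].
  by rewrite /m !ge_min !lexx ?orbT.
have h := kkt_map_bound k.
have a1 : 0 <= ipY (u k.+2) (S (u k.+2)) by case: S_psd => _; apply.
have a2 : 0 <= ipZ (w k.+2) (T (w k.+2)) by case: T_psd => _; apply.
have a3 : 0 <= ipX (resid k.+2) (resid k.+2) by case: (pd_form_psd pX) => _; apply.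
have a4 : 0 <= ipX (dAy k.+1) (dAy k.+1) by case: (pd_form_psd pX) => _; apply.
rewrite -mulrA [leRHS]mulrCA ler_pM2l //.
apply: le_trans (ler_wpM2l (ltW m0) h) _.
rewrite [leLHS]mulrCA ler_pM2l ?kappa_gt0 //.
rewrite [leLHS]mulrDr [m * (_ + _ + _)]mulrDr [m * (_ + _)]mulrDr !lerD //.
- by rewrite ler_piMl.
- by rewrite ler_piMl.
- by rewrite ler_wpM2r.
- by rewrite ler_wpM2r.
Qed.

Lemma distO_contraction k lambda nus : TH nus -> 0 < lambda ->
  dist ip (nu k.+2) TH <= lambda * enorm ip (Rh (nu k.+2)) ->
  (1 + bet lambda) * distX (nu k.+2) ^+ 2 <= distX (nu k.+1) ^+ 2.
Proof.
move=> Ts l0 calm; have TH0 : TH !=set0 by exists nus.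
have [_ qV] := pd_form_psd pV.
have d0 : 0 <= dist ip (nu k.+2) TH by exact: (@distO_ge0 _ _ ip id).
have s1 : distX (nu k.+2) ^+ 2 <= lambda_max XiO * dist ip (nu k.+2) TH ^+ 2.
  rewrite mulrC -ler_pdivrMr //; apply: (@le_distO_sq _ _ ip id) => // th Tth.
  rewrite ler_pdivrMr //; apply: le_trans (distO_sq_le Xi_form_ge0 _ Tth) _.
  rewrite mulrC; apply: (form_le_lambda_max pV).
  exact: Xi_self_adjoint.
have s2 : dist ip (nu k.+2) TH ^+ 2 <= lambda ^+ 2 * ip (Rh (nu k.+2)) (Rh (nu k.+2)).
  rewrite -(enorm_sq _ (pd_form_psd pV)) -exprMn ler_pXn2r ?nnegrE //.
  by rewrite mulr_ge0 ?enorm_ge0 // ltW.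
have s3 : bet lambda * distX (nu k.+2) ^+ 2 <= drop k.
  have lkl : 0 < lambda ^+ 2 * kap * lambda_max XiO.
    by rewrite !mulr_gt0 ?exprn_gt0 ?kappa_gt0.
  have := kkt_map_le_drop k; rewrite /beta; set c0 := (2 - rho) * Num.min _ _ => h.
  have c00 : 0 <= c0.
    have [r0 r2] := andP rho_bnd; have r2' : 0 < 2 - rho by rewrite subr_gt0.
    by rewrite mulr_ge0 ?(ltW r2') // !le_min ler01 !mulr_ge0 ?invr_ge0 ?ltW.
  rewrite mulrAC ler_pdivrMr //.
  apply: le_trans (ler_wpM2l c00 s1) _.
  apply: le_trans (ler_wpM2l c00 (ler_wpM2l (ltW lamXi_gt0) s2)) _.
  have ll : 0 <= lambda_max XiO * lambda ^+ 2.
    by rewrite mulr_ge0 ?sqr_ge0 // ltW.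
  have := ler_wpM2l ll h.
  rewrite (_ : _ * (kap * _) = drop k * (lambda ^+ 2 * kap * lambda_max XiO)); last by ring.
  by apply: le_trans; rewrite le_eqVlt; apply/orP; left; apply/eqP; ring.
(* The decrease does not depend on the reference point [th], so the infimum at the earlier iterate
   may be taken last. *)
apply: le_distO_sq => // th Tth.
rewrite mulrDl mul1r; have h1 := distO_sq_le Xi_form_ge0 (nu k.+2) Tth.
rewrite -[leRHS](subrK (Phi (nu k.+2 - th))) addrC lerD //.
exact: le_trans s3 (Xi_form_descent k Tth).
Qed.

End Algorithm.

Theorem theorem3p2 (R : realType) (X Y Z : vectType R)
  (ipX : {dot X for idfun}) (ipY : {dot Y for idfun}) (ipZ : {dot Z for idfun})
  (V_neq0 : (0 < \dim {: kkt_space X Y Z})%N)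
  (f : Y -> \bar R) (g : Z -> \bar R)
  (f_cpc : closed_proper_convex ipY f) (g_cpc : closed_proper_convex ipZ g)
  (A : 'Hom(X, Y)) (As : 'Hom(Y, X)) (A_adj : is_adjoint ipX ipY A As)
  (B : 'Hom(X, Z)) (Bs : 'Hom(Z, X)) (B_adj : is_adjoint ipX ipZ B Bs)
  (c : X)
  (Sigf : 'End(Y)) (Sigf_psd : psd_op ipY Sigf)
  (Sigf_mon : subdiff_monotone ipY f Sigf)
  (Sigg : 'End(Z)) (Sigg_psd : psd_op ipZ Sigg)
  (Sigg_mon : subdiff_monotone ipZ g Sigg)
  (sigma : R) (sigma_gt0 : 0 < sigma)
  (rho : R) (rho_bnd : 0 < rho < 2)
  (S : 'End(Y)) (S_pd : pd_op ipY S) (T : 'End(Z)) (T_pd : pd_op ipZ T)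
  (Omega_neq0 : exists xs ys zs, Omega ipY ipZ f g A As B Bs c xs ys zs)
  (x xt : nat -> X) (y yt : nat -> Y) (z zt : nat -> Z)
  (gen : pGADMM ipX ipY ipZ f g As Bs c sigma rho S T x xt y yt z zt)
  (lambda : R) (lambda_gt0 : 0 < lambda) :
  let nu := nu_seq x y yt z zt in
  let TH := Theta ipY ipZ f g A As B Bs c in
  let dXi := distO (ipV ipX ipY ipZ) (Xi A As B Bs sigma rho S T Sigf Sigg) in
  let al := alpha ipY ipZ A As B Bs sigma rho S T Sigf Sigg lambda in
  exists (xb : X) (yb : Y) (zb : Z),
    let nub : kkt_space X Y Z := (xb, yb, 0, zb, 0) in
    [/\ TH nub,
        norm_cvg (ipV ipX ipY ipZ) nu nub &
        kkt_calm ipX ipY ipZ f g A As B Bs c lambda nub ->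
        exists kbar : nat,
          [/\ (1 <= kbar)%N,
              forall k, (kbar <= k)%N ->
                dXi (nu k.+1) TH ^+ 2 <= al * dXi (nu k) TH ^+ 2 &
              exists zeta : R,
                [/\ 0 < zeta, al <= zeta, zeta < 1 &
                    forall k, (kbar <= k)%N ->
                      dXi (nu k.+1) TH ^+ 2 <= zeta * dXi (nu k) TH ^+ 2]]].
Proof.
move=> nu TH dXi al.
have pX := dot_pd_form ipX; have pY := dot_pd_form ipY; have pZ := dot_pd_form ipZ.
have pV := ipV_pd_form pX pY pZ.
have S_psd : psd_op ipY S.
  by have [sa _] := S_pd; split=> // v; case: (pd_form_psd (pd_form_op (proj1 pY) S_pd)) => _; apply.
have T_psd : psd_op ipZ T.
  by have [sa _] := T_pd; split=> // v; case: (pd_form_psd (pd_form_op (proj1 pZ) T_pd)) => _; apply.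
have [xs [ys [zs Os]]] := Omega_neq0.
have Ts : TH (xs, ys, 0, zs, 0) by exists xs, ys, zs.
have [nub Tb nuc] := pGADMM_cvg pX pY pZ f_cpc g_cpc A_adj B_adj S_psd T_psd
  Sigf_psd Sigf_mon Sigg_psd Sigg_mon sigma_gt0 rho_bnd gen (proj2 S_pd) (proj2 T_pd) Ts.
have [xb [yb [zb [Ob nubE]]]] := Tb; exists xb, yb, zb => /=; rewrite -nubE.
have nuN e : 0 < e -> exists N, forall k, (N <= k)%N ->
    enorm (ipV ipX ipY ipZ) (nu k.+2 - nub) < e.
  move=> e0; have [N hN] := nuc _ (exprn_gt0 2 e0).
  by exists N => k /hN; apply: enorm_lt => //; exact: pd_form_psd.
split=> //.
  apply/cvgrPdist_lt => e e0; have [N hN] := nuN e e0.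
  exists N.+2 => // -[|[|k]] //= Nk.
  by rewrite sub0r normrN ger0_norm ?enorm_ge0 // hN.
move=> [eps eps0 calm]; have [N hN] := nuN eps eps0.
have b0 : 0 < beta ipY ipZ A As B Bs sigma rho S T Sigf Sigg lambda.
  exact: (beta_gt0 pX pY pZ A_adj B_adj S_psd T_psd Sigf_psd Sigg_psd sigma_gt0
    rho_bnd (proj2 S_pd) (proj2 T_pd) V_neq0 lambda_gt0).
have b1 : 0 < 1 + beta ipY ipZ A As B Bs sigma rho S T Sigf Sigg lambda.
  by rewrite addr_gt0.
(* Calmness is needed only at [nu k.+1]; since [hN] starts at [nu N.+2], the threshold is [N.+1]. *)
have contr k : (N.+1 <= k)%N -> dXi (nu k.+1) TH ^+ 2 <= al * dXi (nu k) TH ^+ 2.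
  case: k => // k Nk; rewrite /al /alpha ler_pdivlMl //.
  apply: (distO_contraction pX pY pZ f_cpc g_cpc A_adj B_adj S_psd T_psd
    Sigf_psd Sigf_mon Sigg_psd Sigg_mon sigma_gt0 rho_bnd gen
    (proj2 S_pd) (proj2 T_pd) V_neq0 Tb lambda_gt0).
  exact/calm/ltW/hN.
exists N.+1; split=> //; exists al; split=> //; first by rewrite invr_gt0.
by rewrite invf_lt1 // ltrDl.
Qed.
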